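(* Let $H_q$ be a periodic Schrödinger operator on $\ell^2(\mathbb{Z})$ of period $q\ge1$, and let $B_q^{(j)}$, $1\le j\le q$, denote the $j$-th band of its spectrum, with width $\ell_j$. Let $\mu_{\varkappa,q}$ be the canonical spectral measure of the Floquet matrix $A_q(\varkappa)$ and let $P_{q,T}(n)$ be the Abel-averaged probabilities associated with $H_q$. Let $I\subset\mathbb{R}$ be an interval and suppose that $\inf_{\varkappa\in[0,\pi/q]}\mu_{\varkappa,q}(I)>\eta>0$. Then there exist a band $B_q^{(j)}$ with $B_q^{(j)}\cap I\ne\varnothing$ and constants $0<c,c_1,C<\infty$ such that for $T>\frac{C}{c_1}\eta^{-2}q^{8}\ell_j^{-2}+1$, $$P_{q,T}(nq)>\frac{c\,\eta^2}{q^6\,\ell_j\,T}$$ for every integer $n$ with $C\eta^{-1}q^4\ell_j^{-1}<n<c_1\eta q^{-4}\ell_jT$.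
   Context: $H_q:\ell^2(\mathbb{Z})\to\ell^2(\mathbb{Z})$ is $(H_q\psi)(n)=\psi(n-1)+\psi(n+1)+V_q(n)\psi(n)$, where $V_q:\mathbb{Z}\to\mathbb{R}$ is periodic of period $q\ge1$. With $\{\delta_n\}_{n\in\mathbb{Z}}$ the canonical basis of $\ell^2(\mathbb{Z})$, for $T>0$ and $n\in\mathbb{Z}$, $$P_{q,T}(n)=\frac2T\int_0^\infty\big(|\langle\delta_n,e^{-itH_q}\delta_0\rangle|^2+|\langle\delta_{n+1},e^{-itH_q}\delta_1\rangle|^2\big)e^{-2t/T}\,dt .$$ Floquet matrix: index the coordinates of $\mathbb{C}^q$ by $q$ consecutive integers $l$ centred around $0$ (in the range $|l|\le q/2$; for even $q$ take $-q/2<l\le q/2$; for $q=1$ the index $1$ is identified with $0$ modulo $q$), with canonical basis vectors $e_l$. For $\varkappa\in\mathbb{R}/\frac{2\pi}{q}\mathbb{Z}$, $A_q(\varkappa)$ is the Hermitian $q\times q$ matrix with diagonal entries $V_q(l)$, entries $1$ on the first super- and sub-diagonals, the additional entry $e^{iq\varkappa}$ in the upper-right corner (row of the smallest index, column of the largest) and the additional entry $e^{-iq\varkappa}$ in the lower-left corner (when $q\le2$ overlapping entries are added). Let $\lambda_1(\varkappa)\le\dots\le\lambda_q(\varkappa)$ be the eigenvalues of $A_q(\varkappa)$, with orthonormal eigenvectors $\Psi^{(1)}_\varkappa,\dots,\Psi^{(q)}_\varkappa$. The bands are the closed intervals $B_q^{(j)}=\{\lambda_j(\varkappa):\varkappa\in[0,\pi/q]\}$,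 $1\le j\le q$; one has $\sigma(H_q)=\bigcup_{j=1}^qB_q^{(j)}$. The width of the $j$-th band is $\ell_j=|B_q^{(j)}|=|\lambda_j(\pi/q)-\lambda_j(0)|$. The canonical spectral measure of $A_q(\varkappa)$ is $$\mu_{\varkappa,q}=\sum_{j=1}^q\varphi_j(\varkappa)\,\delta_{\lambda_j(\varkappa)},\qquad \varphi_j(\varkappa)=|\langle\Psi^{(j)}_\varkappa,e_0\rangle|^2+|\langle\Psi^{(j)}_\varkappa,e_1\rangle|^2,$$ where $\delta_{\lambda}$ here denotes the Dirac measure at $\lambda$. *)

(* Defs.v *)
(* Complex numbers are R[i], for R : realType; on R[i]^o the topology is that of
   the modulus. *)
From mathcomp Require Export all_boot all_order all_algebra.
From mathcomp Require Export all_classical all_reals all_analysis.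
From mathcomp Require Export complex.
From mathcomp Require Import spectral sesquilinear ring lra zify.

Set Implicit Arguments.
Unset Strict Implicit.
Unset Printing Implicit Defensive.

Export Order.TTheory GRing.Theory Num.Theory.
Export numFieldNormedType.Exports.

Local Open Scope classical_set_scope.
Local Open Scope ring_scope.

Section LineOperators.
Variable R : realType.
Implicit Types (V : int -> R) (psi : int -> R[i]).

Definition abs2 (z : R[i]) : R := Normc.normc z ^+ 2.

Definition periodic V (q : nat) : Prop := forall n : int, V (n + q%:Z) = V n.

(* The formula makes sense on all sequences; for bounded V it restricts to a
   bounded operator on l^2(Z). *)
Definition schrodinger V psi : int -> R[i] :=
  fun n => psi (n - 1) + psi (n + 1) + (V n)%:C%C * psi n.

Definition delta (m : int) : int -> R[i] := fun n => (n == m)%:R.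

Definition exp_term (z : R[i]) (A : (int -> R[i]) -> int -> R[i]) psi (n : int)
  (k : nat) : R[i]^o := z ^+ k / k`!%:R * iter k A psi n.

(* n-th coordinate of e^(zA) psi.  For A bounded on l^2(Z) the exponential
   series converges in norm, so its coordinates are the sums of the coordinate
   series; see [is_cvg_exp_schrodinger]. *)
Definition exp_op (z : R[i]) A psi (n : int) : R[i] :=
  limn (series (exp_term z A psi n)).

(* <delta_n, e^(-itH) delta_m> *)
Definition amplitude V (t : R) (n m : int) : R[i] :=
  exp_op (0 -i* t)%C (schrodinger V) (delta m) n.

Definition abel_prob V (T : R) (n : int) : R :=
  2 / T * \int[lebesgue_measure]_(t in `[0, +oo[)
    ((abs2 (amplitude V t n 0) + abs2 (amplitude V t (n + 1) 1))
     * expR (- (2 * t / T))).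

End LineOperators.

Section Floquet.
Variable R : realType.
Implicit Types (V : int -> R) (q : nat).

(* Row i of a q x q matrix carries the integer label l = i - floor((q-1)/2), so
   that l runs over -q/2 < l <= q/2 (q even), resp. |l| <= (q-1)/2 (q odd). *)
Definition site q (i : 'I_q) : int := i%:Z - (q.-1./2)%:Z.

(* The congruence matters only for q = 1 and m = 1, where e_1 = e_0. *)
Definition basis_vec q (m : int) : 'cV[R[i]]_q :=
  \col_i ((site i == m %[mod q%:Z])%Z)%:R.

Definition cinner q (u v : 'cV[R[i]]_q) : R[i] := \sum_i (u i 0)^* * v i 0.

Definition floquet V q (k : R) : 'M[R[i]]_q :=
  \matrix_(i, j)
    ((V (site i))%:C%C *+ (i == j)
     + ((j == i.+1 :> nat) || (i == j.+1 :> nat))%:R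
     + (cos (q%:R * k) +i* sin (q%:R * k))%C
         *+ ((i == 0%N :> nat) && (j == q.-1 :> nat))
     + (cos (q%:R * k) -i* sin (q%:R * k))%C
         *+ ((i == q.-1 :> nat) && (j == 0%N :> nat))).

(* lam is the nondecreasing list of eigenvalues of A with multiplicity, and Psi
   an orthonormal basis of eigenvectors; see [eigensystem_exists]. *)
Definition eigensystem q (A : 'M[R[i]]_q) (lam : 'I_q -> R)
    (Psi : 'I_q -> 'cV[R[i]]_q) : Prop :=
  [/\ forall j j' : 'I_q, (j <= j')%N -> lam j <= lam j',
      forall j j', cinner (Psi j) (Psi j') = (j == j')%:R &
      forall j, A *m Psi j = (lam j)%:C%C *: Psi j].

Definition spectral_weight q (psi : 'cV[R[i]]_q) : R :=
  abs2 (cinner psi (basis_vec q 0)) + abs2 (cinner psi (basis_vec q 1)).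

Definition spectral_measure q (lam : 'I_q -> R) (Psi : 'I_q -> 'cV[R[i]]_q)
    (A : set R) : \bar R :=
  (\sum_(j < q) (spectral_weight (Psi j))%:E * \d_(lam j) A)%E.

Definition band q (lam : R -> 'I_q -> R) (j : 'I_q) : set R :=
  [set lam k j | k in `[0, pi / q%:R]].

Definition band_width q (lam : R -> 'I_q -> R) (j : 'I_q) : R :=
  `|lam (pi / q%:R) j - lam 0 j|.

End Floquet.

Local Open Scope sesquilinear_scope.

Lemma floquet_hermitian (R : realType) (V : int -> R) q (k : R) :
  floquet V q k \is hermsymmx.
Proof.
apply/is_hermitianmxP; rewrite expr0 scale1r; apply/matrixP => i j.
have cE (z : R[i]) : z^* = conjc z by [].
rewrite !mxE !rmorphD !rmorphMn/= rmorph1 !cE /= [j == i]eq_sym.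
have -> : (V (site i))%:C%C *+ (i == j) = (V (site j) -i* 0)%C *+ (i == j) :> R[i].
  by case: eqP => [->|//]; rewrite oppr0.
rewrite opprK [(i == j.+1 :> nat) || _]orbC -!addrA; congr (_ + (_ + _)).
by rewrite addrC [(i == 0%N :> nat) && _]andbC [(i == q.-1 :> nat) && _]andbC.
Qed.

Lemma eigensystem_exists (R : realType) q (A : 'M[R[i]]_q) :
  A \is hermsymmx -> exists lam Psi, eigensystem A lam Psi.
Proof.
move=> Ah; set P := spectralmx A; set D := spectral_diag A.
have /orthomx_spectralP AE := hermitian_normalmx Ah.
have Pu : P \is unitarymx by exact: spectral_unitarymx.
have PP : P *m P^t* = 1%:M by apply/unitarymxP.
have Dr i : D 0 i = (complex.Re (D 0 i))%:C%C.
  rewrite RRe_real //; have /mxOverP := hermitian_spectral_diag_real Ah; exact.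
pose d i := complex.Re (D 0 i).
pose s := sort (fun i j => d i <= d j) (enum 'I_q).
have sz : size s = q by rewrite size_sort size_enum_ord.
have us : uniq s by rewrite sort_uniq enum_uniq.
have ss : sorted (fun i j => d i <= d j) s.
  by apply: sort_sorted => i j; exact: le_total.
pose g (j : 'I_q) := nth j s j.
have gE (x j : 'I_q) : g j = nth x s j by apply: set_nth_default; rewrite sz.
exists (fun j => d (g j)), (fun j => col (g j) (P^t*)); split.
- move=> j j' jj'; rewrite (gE j j').
  apply: (@sorted_leq_nth _ (fun i j => d i <= d j)) => //.
  + by move=> a b c /=; exact: le_trans.
  + by rewrite inE sz ltn_ord.
  + by rewrite inE sz ltn_ord.
- move=> j j'; have := congr1 (fun B : 'M[R[i]]_q => B (g j) (g j')) PP; rewrite !mxE => h.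
  rewrite /cinner (_ : (j == j') = (g j == g j')).
    by rewrite -h; apply: eq_bigr => i _; rewrite !mxE conjCK.
  by rewrite (gE j j') nth_uniq ?sz.
- move=> j; rewrite {1}AE -/P -/D invmx_unitary // [col _ _ in LHS]colE !mulmxA.
  rewrite -[_ *m P *m _]mulmxA PP mulmx1 -colE mul_mx_diag.
  by apply/matrixP => a b; rewrite !mxE Dr mulrC.
Qed.

Lemma periodic_bounded (R : realType) (V : int -> R) q :
  (0 < q)%N -> periodic V q -> exists2 M, 0 <= M & forall n, `|V n| <= M.
Proof.
move=> q0 Vq; exists (\sum_(i < q) `|V i|) => [|n]; first exact: sumr_ge0.
have Vk (k : nat) n' : V (n' + (k * q)%N%:Z) = V n'.
  elim: k n' => [|k IH] n'; first by rewrite mul0n addr0.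
  by rewrite mulSn addnC PoszD addrA Vq IH.
have -> : V n = V (n %% q%:Z)%Z.
  rewrite {1}(divz_eq n q); case: (n %/ q)%Z => k.
    by rewrite addrC -PoszM Vk.
  rewrite -(Vk k.+1); congr V; rewrite NegzE PoszM; ring.
have qz : q%:Z != 0 by rewrite eqz_nat -lt0n.
have := modz_ge0 n qz; have := ltz_pmod n (_ : 0 < q%:Z); rewrite ltz_nat => /(_ q0).
case: (n %% q)%Z => // i; rewrite ltz_nat => iq _.
by rewrite (bigD1 (Ordinal iq)) //= lerDl sumr_ge0.
Qed.

Lemma iter_schrodinger_le (R : realType) (V : int -> R) M m k n :
  (forall n, `|V n| <= M) ->
  `|iter k (schrodinger V) (delta R m) n| <= ((2 + M) ^+ k)%:C%C.
Proof.
move=> VM; elim: k n => [|k IH] n.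
  by rewrite /= /delta expr0; case: eqP => _; rewrite ?normr1 ?normr0 ?ler01.
rewrite iterS exprS mulrDl !rmorphD /=.
have -> : (2 : R) * (2 + M) ^+ k = (2 + M) ^+ k + (2 + M) ^+ k by ring.
rewrite rmorphD /=.
rewrite /schrodinger (le_trans (ler_normD _ _)) // lerD //.
  by rewrite (le_trans (ler_normD _ _)) // lerD.
rewrite normrM rmorphM /= ler_pM //.
by rewrite normc_def /= expr0n addr0 sqrtr_sqr lecR.
Qed.

Lemma is_cvg_exp_schrodinger (R : realType) (V : int -> R) q (z : R[i]) m n :
  (0 < q)%N -> periodic V q ->
  cvgn (series (exp_term z (schrodinger V) (delta R m) n)).
Proof.
move=> q0 Vq; have [M M0 VM] := periodic_bounded q0 Vq.
set u := exp_term _ _ _ _.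
set a := Normc.normc z * (2 + M).
have uE k : `|u k| <= (exp_coeff a k)%:C%C.
  rewrite /u /exp_term normrM normf_div normrX normr_nat /exp_coeff /=.
  rewrite mulrAC rmorphM /= exprMn rmorphM /= fmorphV rmorph_nat.
  rewrite ler_pM2r ?invr_gt0 ?ltr0n ?fact_gt0 //.
  rewrite rmorphXn /= normc_def -/(Normc.normc z).
  have -> : Num.sqrt (complex.Re z ^+ 2 + complex.Im z ^+ 2) = Normc.normc z.
    by case: (z).
  rewrite ler_wpM2l ?exprn_ge0 ?ler0c //; last exact: iter_schrodinger_le.
  by case: (z) => x y; rewrite /= sqrtr_ge0.
have a0 : 0 <= a.
  by rewrite mulr_ge0 ?addr_ge0 //; case: (z) => x y; rewrite /= sqrtr_ge0.
have part (f : R[i] -> R) : (forall w, `|f w|%:C%C <= `|w|) ->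
    cvgn (series (f \o u : R^o ^nat)).
  move=> fle; apply: normed_cvg; apply: series_le_cvg (is_cvg_series_exp_coeff a).
  - by move=> k /=.
  - by move=> k; exact: exp_coeff_ge0.
  - by move=> k; rewrite -lecR (le_trans (fle _)).
have Rle w : `|complex.Re w|%:C%C <= `|w| :> R[i] by exact: normc_ge_Re.
have Ile w : `|complex.Im w|%:C%C <= `|w| :> R[i].
  by rewrite normc_def lecR -sqrtr_sqr ler_wsqrtr // lerDr sqr_ge0.
have /cvg_ex[/= x Rx] := part _ Rle; have /cvg_ex[/= y Iy] := part _ Ile.
apply/cvg_ex; exists (x +i* y)%C; apply/cvgrPdist_lt => e e0.
have eE : e = (complex.Re e)%:C%C by rewrite RRe_real // gtr0_real.
have re0 : 0 < complex.Re e by rewrite -ltcR -eE.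
have h0 : 0 < complex.Re e / 2 by rewrite divr_gt0.
move/cvgrPdist_lt : Rx => /(_ _ h0) Rx.
move/cvgrPdist_lt : Iy => /(_ _ h0) Iy.
have sE N : series u N =
    (series (@complex.Re R \o u) N +i* series (@complex.Im R \o u) N)%C.
  rewrite /series /=; elim: N => [|k IH]; first by rewrite !big_geq.
  by rewrite !big_nat_recr //= IH; case: (u k).
near=> N.
rewrite sE eE.
have -> : ((x +i* y)%C - (series (@complex.Re R \o u) N +i* series (@complex.Im R \o u) N)%C : R[i])
  = (x - series (@complex.Re R \o u) N)%:C%C + ('i * (y - series (@complex.Im R \o u) N)%:C)%C.
  by apply/eqP; rewrite eq_complex /= !mul0r !mul1r !subr0 !addr0 !add0r !eqxx.
have nR (r : R) : `|r%:C%C : R[i]| = `|r|%:C%C.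
  by rewrite normc_def /= expr0n addr0 sqrtr_sqr.
apply: le_lt_trans (ler_normD _ _) _; rewrite normrM !nR.
have -> : `|'i%C : R[i]| = 1 by rewrite normc_def /= expr0n expr1n add0r sqrtr1.
rewrite mul1r -rmorphD ltcR [ltRHS](splitr (complex.Re e)) ltrD //.
  by near: N.
by near: N.
Unshelve. all: by end_near. Qed.

(* Main.v *)
(* Write z = E + i/T.  The Laplace transform of the amplitude
   <delta_(nq+m), e^(-itH) delta_m> at z is, up to a factor i, the Green function
   a_m(z) w^n / (1/w - w), where a_m(z) is the (m, m) minor of z - A(k) (it does
   not depend on k), det (z - A(k)) = D(z) - 2 cos(qk), w + 1/w = D(z) and
   |w| < 1.  At k = pi/(2q) pick an eigenvalue E_0 in I of weight > eta/q; it
   lies inside a band of width l.  By Cauchy interlacing no root of a_m and no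
   root of D - 2 or D + 2 lies strictly inside the band, and comparing the
   real-rooted products at E_0 and at the band edges shows that
     - E_0 is at distance at least l/(2q) from the edges,
     - |a_m(z)| >= (weight of E_0)/l for E within l/(4q^2) of E_0,
     - |w| + 1/|w| = (|D(z) - 2| + |D(z) + 2|)/2 is so close to 2 that
       |w|^n >= 1/2 in the stated range of n.
   Integrating the square of the Green function over these E (Plancherel) gives
   the bound.  Plancherel and unitarity are needed only for finite sums of
   exponentials: the amplitude is the limit, as N -> oo, of the amplitude on the
   ring of N periods, which Bloch waves at the N-th roots of unity diagonalise;
   there Bessel's inequality for trigonometric functions on [0, L] suffices. *)
Require Import Defs.
From mathcomp Require Import measurable_realfun ring lra zify.

Set Implicit Arguments.
Unset Strict Implicit.
Unset Printing Implicit Defensive.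

Local Open Scope classical_set_scope.
Local Open Scope ring_scope.

(** * Moduli and phases of complex numbers *)

Section Modulus.
Variable R : realType.
Local Notation C := R[i].
Local Notation nc := (@Normc.normc R).
Implicit Types z w : C.

Lemma ncE z : `|z| = (nc z)%:C%C.
Proof. by rewrite normc_def; case: z. Qed.

Lemma nc_ge0 z : 0 <= nc z.
Proof. by case: z => a b; exact: sqrtr_ge0. Qed.

Lemma ncN z : nc (- z) = nc z.
Proof. by apply: complexI; rewrite -!ncE normrN. Qed.

Lemma nc_leD z w : nc (z + w) <= nc z + nc w.
Proof. by rewrite -lecR rmorphD /= -!ncE ler_normD. Qed.

Lemma nc_geB z w : nc z - nc w <= nc (z + w).
Proof.
have := nc_leD (z + w) (- w); rewrite addrK ncN; lra.
Qed.

Lemma ncX z n : nc (z ^+ n) = nc z ^+ n.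
Proof. by apply: complexI; rewrite rmorphXn /= -!ncE normrX. Qed.

Lemma nc_sum (I : Type) (r : seq I) (P : pred I) (F : I -> C) :
  nc (\sum_(i <- r | P i) F i) <= \sum_(i <- r | P i) nc (F i).
Proof.
elim/big_ind2 : _ => //; first by rewrite Normc.normc0.
by move=> *; apply: le_trans (nc_leD _ _) _; rewrite lerD.
Qed.

Lemma nc_prod (I : Type) (r : seq I) (P : pred I) (F : I -> C) :
  nc (\prod_(i <- r | P i) F i) = \prod_(i <- r | P i) nc (F i).
Proof.
by apply: (big_morph nc (@Normc.normcM R)); rewrite Normc.normc1.
Qed.

Lemma nc_real (x : R) : nc x%:C%C = `|x|.
Proof. by rewrite /= expr0n addr0 sqrtr_sqr. Qed.

Lemma nc_nat n : nc n%:R = n%:R.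
Proof. by rewrite -(rmorph_nat (real_complex R)) nc_real ger0_norm. Qed.

Lemma nc_eq0 z : (nc z == 0) = (z == 0).
Proof.
by apply/eqP/eqP => [/Normc.eq0_normc //|->]; exact: Normc.normc0.
Qed.

Lemma nc_sqr z : nc z ^+ 2 = complex.Re z ^+ 2 + complex.Im z ^+ 2.
Proof. by case: z => a b /=; rewrite sqr_sqrtr // addr_ge0 ?sqr_ge0. Qed.

Lemma nc_conj z : nc z^* = nc z.
Proof. by apply: complexI; rewrite -!ncE; exact: norm_conjC. Qed.

Lemma Re_le_nc z : `|complex.Re z| <= nc z.
Proof. by rewrite -lecR -ncE normc_ge_Re. Qed.

Lemma Im_le_nc z : `|complex.Im z| <= nc z.
Proof.
by case: z => a b /=; rewrite -sqrtr_sqr ler_wsqrtr // lerDr sqr_ge0.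
Qed.

Lemma nc_le_ReIm z : nc z <= `|complex.Re z| + `|complex.Im z|.
Proof.
have h : 0 <= `|complex.Re z| * `|complex.Im z| by rewrite mulr_ge0.
rewrite -(ler_pXn2r (_ : 0 < 2)%N) ?nnegrE ?addr_ge0 ?nc_ge0 //.
rewrite nc_sqr sqrrD !real_normK ?num_real //; lra.
Qed.

Lemma conjCE z : z^* = conjc z.
Proof. by []. Qed.

Lemma conjM z w : (z * w)^* = z^* * w^*.
Proof. exact: rmorphM. Qed.

Lemma conj_sum (I : Type) (r : seq I) (P : pred I) (F : I -> C) :
  (\sum_(i <- r | P i) F i)^* = \sum_(i <- r | P i) (F i)^*.
Proof. exact: rmorph_sum. Qed.

Lemma mul_conjE z : z * z^* = (nc z ^+ 2)%:C%C.
Proof. by rewrite rmorphXn /= -ncE normCK. Qed.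

Lemma ReD z w : complex.Re (z + w) = complex.Re z + complex.Re w.
Proof. by case: z w => [a b] [c d]. Qed.

Lemma Re_sum (I : Type) (r : seq I) (P : pred I) (F : I -> C) :
  complex.Re (\sum_(i <- r | P i) F i) = \sum_(i <- r | P i) complex.Re (F i).
Proof. by apply: (big_morph (@complex.Re R) ReD). Qed.

Lemma Im_sum (I : Type) (r : seq I) (P : pred I) (F : I -> C) :
  complex.Im (\sum_(i <- r | P i) F i) = \sum_(i <- r | P i) complex.Im (F i).
Proof. by apply: (big_morph (@complex.Im R)) => // -[a b] [c d]. Qed.

Definition cis (x : R) : C := (cos x +i* sin x)%C.

Lemma cis0 : cis 0 = 1.
Proof. by rewrite /cis cos0 sin0. Qed.

Lemma cisD x y : cis (x + y) = cis x * cis y.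
Proof.
rewrite /cis cosD sinD; apply/eqP; rewrite eq_complex /=; apply/andP; split=> //.
by apply/eqP; ring.
Qed.

Lemma conj_cis x : (cis x)^* = cis (- x).
Proof. by rewrite conjCE /cis cosN sinN. Qed.

Lemma nc_cis x : nc (cis x) = 1.
Proof. by rewrite /= cos2Dsin2 sqrtr1. Qed.

Lemma cis_neq0 x : cis x != 0.
Proof. by rewrite -nc_eq0 nc_cis oner_eq0. Qed.

Lemma cisN x : cis (- x) = (cis x)^-1.
Proof. by apply: (mulfI (cis_neq0 x)); rewrite -cisD subrr cis0 mulfV ?cis_neq0. Qed.

Lemma cisX x n : cis x ^+ n = cis (n%:R * x).
Proof.
elim: n => [|n IH]; first by rewrite mul0r cis0.
by rewrite exprS IH -cisD; congr cis; rewrite -natr1 mulrDl mul1r addrC.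
Qed.

Lemma cisDN x : cis x + cis (- x) = (2 * cos x)%:C%C.
Proof.
rewrite /cis cosN sinN; apply/eqP; rewrite eq_complex /= subrr eqxx andbT.
by apply/eqP; ring.
Qed.

End Modulus.

(** * Determinants of cyclic tridiagonal matrices *)

Section CyclicDeterminant.
Variable F : fieldType.

Lemma det_addZ_delta n (B : 'M[F]_n) i j c :
  \det (B + c *: delta_mx i j) = \det B + c * cofactor B i j.
Proof.
rewrite (expand_det_row _ i) (expand_det_row B i).
have cofE l : cofactor (B + c *: delta_mx i j) i l = cofactor B i l.
  rewrite /cofactor; congr (_ * \det _); apply/matrixP => a b; rewrite !mxE.
  by rewrite eq_sym (negbTE (neq_lift _ _)) /= mulr0 addr0.
under eq_bigr do rewrite cofE !mxE eqxx /= mulrDl.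
rewrite big_split /=; congr (_ + _); rewrite (bigD1 j) //= eqxx mulr1 big1 ?addr0 // => l.
by move=> /negbTE ->; rewrite mulr0 mul0r.
Qed.

Definition tridiag_mx n (W : 'I_n -> F) : 'M[F]_n :=
  \matrix_(i, j) (W i *+ (i == j) - ((j == i.+1 :> nat) || (i == j.+1 :> nat))%:R).

Definition ring_mx n (W : 'I_n -> F) (x y : F) : 'M[F]_n :=
  \matrix_(i, j) (tridiag_mx W i j
    - x *+ ((i == 0%N :> nat) && (j == n.-1 :> nat))
    - y *+ ((i == n.-1 :> nat) && (j == 0%N :> nat))).

Lemma cofactor_tr n (B : 'M[F]_n) i j : cofactor B^T i j = cofactor B j i.
Proof.
rewrite /cofactor addnC; congr (_ * _); rewrite -det_tr; congr (\det _).
by apply/matrixP => a b; rewrite !mxE.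
Qed.

Lemma tridiag_tr n (W : 'I_n -> F) : (tridiag_mx W)^T = tridiag_mx W.
Proof.
apply/matrixP => i j; rewrite !mxE orbC eq_sym.
by case: eqP => [->|].
Qed.

Lemma det_tridiag_corner p (W : 'I_p.+1 -> F) :
  \det (row' ord0 (col' ord_max (tridiag_mx W))) = (-1) ^+ p.
Proof.
have neq_lifts (i j : 'I_p) : (j <= i)%N -> (lift ord0 i == lift ord_max j) = false.
  by move=> ji; apply/negP => /eqP /(congr1 (@nat_of_ord _)); rewrite lift0 lift_max; lia.
rewrite -det_tr det_trig.
  under eq_bigr => i _.
    rewrite !mxE neq_lifts // lift0 lift_max eqxx orbT sub0r; over.
  by rewrite prodr_const card_ord.
apply/is_trig_mxP => i j ij; rewrite !mxE (neq_lifts _ _ (ltnW ij)) mulr0n sub0r lift0 lift_max.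
have -> : (i == j.+2 :> nat) = false by apply/negbTE; rewrite neq_ltn (ltn_trans ij).
have -> : (j.+1 == i.+1 :> nat) = false by apply/negbTE; rewrite eqSS neq_ltn ij orbT.
by rewrite oppr0.
Qed.

Lemma cofactor_tridiag_corner p (W : 'I_p.+1 -> F) :
  cofactor (tridiag_mx W) ord0 ord_max = 1.
Proof. by rewrite /cofactor det_tridiag_corner add0n -expr2 sqrr_sign. Qed.

Lemma ring_mxE p (W : 'I_p.+1 -> F) x y :
  ring_mx W x y = tridiag_mx W + (- y) *: delta_mx ord_max ord0
    + (- x) *: delta_mx ord0 ord_max.
Proof.
apply/matrixP => i j; rewrite !mxE /= -!(inj_eq val_inj) /=.
by rewrite !mulrb; do 2![case: (_ && _)]; rewrite ?mulr1 ?mulr0; ring.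
Qed.

Lemma det_ring_mx p (W : 'I_p.+1 -> F) :
  exists K, forall x y, x * y = 1 -> \det (ring_mx W x y) = K - x - y.
Proof.
have [kap kapE] : exists kap, forall y,
    cofactor (tridiag_mx W + (- y) *: delta_mx ord_max ord0) ord0 ord_max
      = 1 - y * kap.
  case: p W => [|p] W.
    by exists 0 => y; rewrite /cofactor det_mx00 mulr0 subr0 mulr1 expr0.
  pose T := row' ord0 (col' ord_max (tridiag_mx W)).
  exists ((-1) ^+ p.+1 * cofactor T ord_max ord0) => y.
  rewrite {1}/cofactor add0n /=.
  have -> : row' ord0 (col' ord_max (tridiag_mx W + - y *: delta_mx ord_max ord0))
      = T + (- y) *: delta_mx ord_max ord0.
    apply/matrixP => i j; rewrite !mxE; congr (_ - _ + _ * _).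
    by rewrite -!(inj_eq val_inj) /= /bump /=; congr (_ && _)%:R; have := ltn_ord j; lia.
  rewrite det_addZ_delta det_tridiag_corner mulrDr -expr2 sqrr_sign; ring.
exists (\det (tridiag_mx W) + kap) => x y xy.
rewrite ring_mxE !det_addZ_delta kapE -(cofactor_tr _ ord0) tridiag_tr.
by rewrite cofactor_tridiag_corner; ring: xy.
Qed.

(* The cofactor is the increment of the determinant when the m-th diagonal entry
   increases by 1. *)
Lemma cofactor_ring_mx p (W : 'I_p.+1 -> F) (m : 'I_p.+1) :
  exists a, forall x y, x * y = 1 -> cofactor (ring_mx W x y) m m = a.
Proof.
have [K KE] := det_ring_mx W.
have [K' K'E] := det_ring_mx (fun i => W i + (i == m)%:R).
exists (K' - K) => x y xy.
have := det_addZ_delta (ring_mx W x y) m m 1; rewrite mul1r scale1r KE // => h.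
suff <- : \det (ring_mx W x y + delta_mx m m) - (K - x - y) =
    cofactor (ring_mx W x y) m m.
  have -> : ring_mx W x y + delta_mx m m = ring_mx (fun i => W i + (i == m)%:R) x y.
    apply/matrixP => i j; rewrite !mxE.
    have [->|ij] := eqVneq i j; first by rewrite andbb !mulr1n !(addrAC _ (j == m)%:R).
    suff -> : (i == m) && (j == m) = false by rewrite !mulr0n addr0.
    by apply/negbTE/negP => /andP[/eqP im /eqP jm]; rewrite im jm eqxx in ij.
  by rewrite K'E //; ring.
by rewrite h; ring.
Qed.

End CyclicDeterminant.

(** * Eigensystems and Cauchy interlacing *)

Lemma exists_ker_vector (F : fieldType) p (M : 'M[F]_(p, p.+1)) :
  exists2 v : 'cV_p.+1, v != 0 & M *m v = 0.
Proof.
have : kermx M^T != 0.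
  by rewrite kermx_eq0 /row_free neq_ltn ltnS rank_leq_col.
move=> /rowV0Pn[u uM u0]; exists u^T; first by rewrite trmx_eq0.
by apply: trmx_inj; rewrite trmx_mul trmxK trmx0; exact/sub_kermxP.
Qed.

Section Eigensystem.
Variable R : realType.
Local Notation C := R[i].
Local Notation nc := (@Normc.normc R).

Lemma cinner_norm n (v : 'cV[C]_n) : cinner v v = (\sum_i nc (v i 0) ^+ 2)%:C%C.
Proof.
rewrite rmorph_sum /=; apply: eq_bigr => i _.
by rewrite mulrC mul_conjE.
Qed.

Lemma conj_cinner n (u v : 'cV[C]_n) : (cinner u v)^* = cinner v u.
Proof.
by rewrite conj_sum; apply: eq_bigr => i _; rewrite conjM conjCK mulrC.
Qed.

Variables (n : nat) (A : 'M[C]_n) (lam : 'I_n -> R) (Psi : 'I_n -> 'cV[C]_n).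
Hypothesis es : eigensystem A lam Psi.

Let U : 'M[C]_n := \matrix_(i, j) Psi j i 0.
Let Ud : 'M[C]_n := \matrix_(j, i) (Psi j i 0)^*.
Let Lam (f : 'I_n -> C) : 'M[C]_n := diag_mx (\row_j f j).

Let UdU : Ud *m U = 1%:M.
Proof.
case: es => _ orth _; apply/matrixP => i j; rewrite !mxE -orth.
by apply: eq_bigr => k _; rewrite !mxE.
Qed.

Let UUd : U *m Ud = 1%:M.
Proof. exact: mulmx1C. Qed.

Let AU : A *m U = U *m Lam (fun j => (lam j)%:C%C).
Proof.
case: es => _ _ eig; apply/matrixP => i j.
rewrite mul_mx_diag !mxE.
have := congr1 (fun v : 'cV[C]_n => v i 0) (eig j); rewrite !mxE mulrC => <-.
by apply: eq_bigr => k _; rewrite !mxE.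
Qed.

Let AE : A = U *m Lam (fun j => (lam j)%:C%C) *m Ud.
Proof. by rewrite -AU -mulmxA UUd mulmx1. Qed.

Lemma eigensystem_weights (m : 'I_n) : \sum_j nc (Psi j m 0) ^+ 2 = 1.
Proof.
have := congr1 (fun B : 'M[C]_n => B m m) UUd; rewrite !mxE eqxx => h.
apply: complexI; rewrite rmorph_sum /= -[RHS]h; apply: eq_bigr => j _.
by rewrite !mxE mul_conjE.
Qed.

Lemma parseval (u v : 'cV[C]_n) :
  cinner u v = \sum_j (cinner (Psi j) u)^* * cinner (Psi j) v.
Proof.
have -> : cinner u v = \sum_i (u i 0)^* * (U *m (Ud *m v)) i 0.
  by rewrite mulmxA UUd mul1mx.
under eq_bigr do rewrite mxE mulr_sumr.
rewrite exchange_big; apply: eq_bigr => j _ /=.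
have -> : cinner (Psi j) v = (Ud *m v) j 0.
  by rewrite mxE; apply: eq_bigr => i _; rewrite mxE.
rewrite conj_cinner mulr_suml; apply: eq_bigr => i _.
by rewrite mxE mulrA.
Qed.

Lemma cinner_eigen j (v : 'cV[C]_n) :
  cinner (Psi j) (A *m v) = (lam j)%:C%C * cinner (Psi j) v.
Proof.
have cE w : cinner (Psi j) w = (Ud *m w) j 0.
  by rewrite mxE; apply: eq_bigr => i _; rewrite mxE.
rewrite !cE {1}AE !mulmxA UdU mul1mx -mulmxA mul_diag_mx !mxE.
by congr (_ * _); apply: eq_bigr => i _; rewrite !mxE.
Qed.

Lemma cinner_normE (v : 'cV[C]_n) :
  cinner v v = (\sum_j nc (cinner (Psi j) v) ^+ 2)%:C%C.
Proof.
by rewrite parseval rmorph_sum; apply: eq_bigr => j _; rewrite mulrC mul_conjE.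
Qed.

Lemma quadratic_formE (v : 'cV[C]_n) :
  cinner v (A *m v) = (\sum_j lam j * nc (cinner (Psi j) v) ^+ 2)%:C%C.
Proof.
rewrite parseval rmorph_sum; apply: eq_bigr => j _.
by rewrite cinner_eigen rmorphM /= mulrCA -mul_conjE [X in _ * X]mulrC.
Qed.

Lemma det_eigen (z : C) : \det (z%:M - A) = \prod_j (z - (lam j)%:C%C).
Proof.
have -> : z%:M - A = U *m Lam (fun j => z - (lam j)%:C%C) *m Ud.
  have -> : Lam (fun j => z - (lam j)%:C%C) = z%:M - Lam (fun j => (lam j)%:C%C).
    by apply/matrixP => i j; rewrite !mxE; case: eqP => [->|] //=; rewrite ?mulr1n ?mulr0n ?subr0.
  by rewrite mulmxBr mulmxBl -AE mul_mx_scalar -scalemxAl UUd scalemx1.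
rewrite !det_mulmx mulrC mulrA -det_mulmx UdU det1 mul1r det_diag.
by apply: eq_bigr => j _; rewrite mxE.
Qed.

Lemma cofactor_eigen (m : 'I_n) (z : C) : (forall j, z != (lam j)%:C%C) ->
  cofactor (z%:M - A) m m =
  \prod_j (z - (lam j)%:C%C) * \sum_j (nc (Psi j m 0) ^+ 2)%:C%C / (z - (lam j)%:C%C).
Proof.
move=> zn; have z0 j : z - (lam j)%:C%C != 0 by rewrite subr_eq0.
pose B := U *m Lam (fun j => (z - (lam j)%:C%C)^-1) *m Ud.
have BE : (z%:M - A) *m B = 1%:M.
  rewrite mulmxBl mul_scalar_mx {1}AE /B.
  rewrite !mulmxA -[_ *m Ud *m U]mulmxA UdU mulmx1 -[U *m _ *m Lam _]mulmxA.
  rewrite scalemxAl scalemxAr -mulmxBl -mulmxBr -[RHS]UUd; congr (_ *m _).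
  rewrite -[RHS]mulmx1; congr (_ *m _); apply/matrixP => i j.
  rewrite mul_diag_mx !mxE; case: eqP => [->|] /=; last by rewrite !mulr0n !mulr0 subrr.
  by rewrite !mulr1n -mulrBl mulfV.
have : \adj (z%:M - A) = (\det (z%:M - A)) *: B.
  by rewrite -[LHS]mulmx1 -BE mulmxA mul_adj_mx mul_scalar_mx.
move=> /(congr1 (fun D : 'M[C]_n => D m m)); rewrite !mxE det_eigen => ->.
congr (_ * _); apply: eq_bigr => j _.
by rewrite mul_mx_diag !mxE mulrAC mul_conjE.
Qed.

Lemma iter_mulmx_eigen (m : 'I_n) k :
  iter k (mulmx A) (delta_mx m 0 : 'cV[C]_n) m 0 =
  \sum_j (nc (Psi j m 0) ^+ 2)%:C%C * (lam j)%:C%C ^+ k.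
Proof.
have -> : iter k (mulmx A) (delta_mx m 0 : 'cV[C]_n) =
    U *m Lam (fun j => (lam j)%:C%C ^+ k) *m (Ud *m delta_mx m 0).
  elim: k => [|k IH].
    rewrite /= mulmxA; have -> : Lam (fun=> 1) = 1%:M.
      by apply/matrixP => i j; rewrite !mxE.
    by rewrite mulmx1 UUd mul1mx.
  rewrite iterS IH mulmxA (mulmxA A U) AU -(mulmxA U); congr (_ *m _ *m _).
  apply/matrixP => i j.
  rewrite mul_diag_mx !mxE exprS; case: eqP => [->|]; rewrite ?mulr1n ?mulr0n ?mulr0 //.
rewrite mxE; apply: eq_bigr => j _.
rewrite mul_mx_diag -colE !mxE mulrAC; congr (_ * _).
by rewrite mul_conjE.
Qed.

End Eigensystem.

Section Cauchy.
Variable R : realType.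
Local Notation C := R[i].
Local Notation nc := (@Normc.normc R).
Variables (p : nat) (A : 'M[C]_p.+1) (m : 'I_p.+1).
Variables (lam : 'I_p.+1 -> R) (Psi : 'I_p.+1 -> 'cV[C]_p.+1).
Variables (mu : 'I_p -> R) (Phi : 'I_p -> 'cV[C]_p).
Hypothesis esA : eigensystem A lam Psi.
Hypothesis esB : eigensystem (row' m (col' m A)) mu Phi.

Let extend (u : 'cV[C]_p) : 'cV[C]_p.+1 :=
  \col_a (if unlift m a is Some b then u b 0 else 0).

Let adjrow q (u : 'cV[C]_q) : 'rV[C]_q := \row_a (u a 0)^*.

Let adjrowE q (u v : 'cV[C]_q) : (adjrow u *m v) 0 0 = cinner u v.
Proof. by rewrite mxE; apply: eq_bigr => i _; rewrite mxE. Qed.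

Let big_lift0 (F : 'I_p.+1 -> C) :
  F m = 0 -> \sum_a F a = \sum_b F (lift m b).
Proof.
move=> Fm; by rewrite (bigD1_ord m) //= Fm add0r.
Qed.

Let restrict (v : 'cV[C]_p.+1) : 'cV[C]_p := \col_b v (lift m b) 0.

Let cinner_extend (u : 'cV[C]_p) (v : 'cV[C]_p.+1) : cinner (extend u) v = cinner u (restrict v).
Proof.
rewrite /cinner big_lift0; last by rewrite mxE unlift_none conjC0 mul0r.
by apply: eq_bigr => b _; rewrite !mxE liftK.
Qed.

Let restrict_form (v : 'cV[C]_p.+1) : v m 0 = 0 ->
  cinner v (A *m v) = cinner (restrict v) (row' m (col' m A) *m restrict v).
Proof.
move=> vm; rewrite /cinner big_lift0; last by rewrite vm conjC0 mul0r.
apply: eq_bigr => b _; rewrite !mxE big_lift0; last by rewrite vm mulr0.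
by congr (_ * _); apply: eq_bigr => c _; rewrite !mxE.
Qed.

Let restrict_norm (v : 'cV[C]_p.+1) : v m 0 = 0 -> cinner v v = cinner (restrict v) (restrict v).
Proof.
move=> vm; rewrite /cinner big_lift0; last by rewrite vm mulr0.
by apply: eq_bigr => b _; rewrite !mxE.
Qed.

Lemma cauchy_interlacing_common (i : 'I_p) (c : 'I_p -> 'cV[C]_p.+1) :
  c i = delta_mx m 0 ->
  exists v : 'cV[C]_p.+1, [/\ v != 0, v m 0 = 0 & forall l, cinner (c l) v = 0].
Proof.
move=> ci; have [v v0 Mv] := exists_ker_vector (\matrix_(l < p) adjrow (c l)).
have h l : cinner (c l) v = 0.
  by rewrite -adjrowE -[adjrow _](rowK (fun l => adjrow (c l))) -row_mul Mv !mxE.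
exists v; split => //; rewrite -[RHS](h i) ci /cinner (bigD1 m) //= big1.
  by rewrite !mxE eqxx conjC1 mul1r addr0.
by move=> a /negbTE am; rewrite mxE am conjC0 mul0r.
Qed.

Let form_gt0 n (v : 'cV[C]_n) : v != 0 -> 0 < \sum_i nc (v i 0) ^+ 2.
Proof.
move=> v0; rewrite lt_neqAle sumr_ge0 ?andbT; last by move=> i _; rewrite sqr_ge0.
apply: contra v0; rewrite eq_sym psumr_eq0; last by move=> i _; rewrite sqr_ge0.
move=> /allP h; apply/eqP/matrixP => i j; rewrite ord1 mxE; apply/eqP.
by rewrite -nc_eq0 -sqrf_eq0; apply: h; rewrite mem_index_enum.
Qed.


Let cauchy_forms (v : 'cV[C]_p.+1) : v != 0 -> v m 0 = 0 ->
  let y l := nc (cinner (Psi l) v) ^+ 2 in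
  let w l := nc (cinner (Phi l) (restrict v)) ^+ 2 in
  [/\ 0 < \sum_l y l, \sum_l y l = \sum_l w l &
      \sum_l lam l * y l = \sum_l mu l * w l].
Proof.
move=> v0 vm y w; have vpos := form_gt0 v0.
have yE : \sum_l y l = \sum_a nc (v a 0) ^+ 2.
  by apply: complexI; rewrite -(cinner_normE esA) cinner_norm.
split; first by rewrite yE.
  apply: complexI; rewrite -(cinner_normE esA) restrict_norm //.
  by rewrite (cinner_normE esB).
apply: complexI; rewrite -(quadratic_formE esA) restrict_form //.
by rewrite (quadratic_formE esB).
Qed.

Lemma cauchy_interlacing_le (i : 'I_p) : lam (widen_ord (leqnSn p) i) <= mu i.
Proof.
pose c l := if l == i then delta_mx m 0
  else if (l < i)%N then Psi (widen_ord (leqnSn p) l) else extend (Phi l).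
have [|v [v0 vm cv]] := @cauchy_interlacing_common i c; first by rewrite /c eqxx.
have [y0 yw forms] := cauchy_forms v0 vm.
have [mlam _ _] := esA; have [mmu _ _] := esB.
rewrite -(ler_pM2r y0) {2}yw !mulr_sumr.
apply: (@le_trans _ _ (\sum_l lam l * nc (cinner (Psi l) v) ^+ 2)).
  apply: ler_sum => l _; have [il|li] := leqP i l.
    by rewrite ler_wpM2r ?sqr_ge0 // mlam.
  have lp : (l < p)%N by rewrite (ltn_trans li).
  have := cv (Ordinal lp); rewrite /c -(inj_eq val_inj) /= (ltn_eqF li) li.
  rewrite (_ : widen_ord _ _ = l) => [->|]; last exact: val_inj.
  by rewrite Normc.normc0 expr0n !mulr0.
rewrite forms; apply: ler_sum => l _; have [li|il] := leqP l i.
  by rewrite ler_wpM2r ?sqr_ge0 // mmu.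
have := cv l; rewrite /c -(inj_eq val_inj) /= (gtn_eqF il) ltnNge (ltnW il) /=.
by rewrite cinner_extend => ->; rewrite Normc.normc0 expr0n !mulr0.
Qed.

Lemma cauchy_interlacing_ge (i : 'I_p) : mu i <= lam (lift ord0 i).
Proof.
pose c l := if l == i then delta_mx m 0
  else if (l < i)%N then extend (Phi l) else Psi (lift ord0 l).
have [|v [v0 vm cv]] := @cauchy_interlacing_common i c; first by rewrite /c eqxx.
have [y0 yw forms] := cauchy_forms v0 vm.
have [mlam _ _] := esA; have [mmu _ _] := esB.
rewrite -(ler_pM2r y0) {1}yw !mulr_sumr.
apply: (@le_trans _ _ (\sum_l mu l * nc (cinner (Phi l) (restrict v)) ^+ 2)).
  apply: ler_sum => l _; have [il|li] := leqP i l.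
    by rewrite ler_wpM2r ?sqr_ge0 // mmu.
  have := cv l; rewrite /c -(inj_eq val_inj) /= (ltn_eqF li) li.
  by rewrite cinner_extend => ->; rewrite Normc.normc0 expr0n !mulr0.
rewrite -forms; apply: ler_sum => l _; have [li|il] := leqP l i.+1.
  by rewrite ler_wpM2r ?sqr_ge0 // mlam // lift0.
have [l' lE|lE] := unliftP ord0 l; last by rewrite lE in il.
rewrite lE lift0 ltnS in il.
have := cv l'; rewrite /c -(inj_eq val_inj) /= (gtn_eqF il) ltnNge (ltnW il) /=.
by rewrite -lE => ->; rewrite Normc.normc0 expr0n !mulr0.
Qed.

End Cauchy.

(** * Bands of the Floquet matrix *)

Lemma eq_poly_horner (R : realType) (f g : {poly R}) :
  (forall x, f.[x] = g.[x]) -> f = g.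
Proof.
move=> fg; apply/eqP; rewrite -subr_eq0; apply/eqP.
pose s := [seq (i%:R : R) | i <- iota 0 (size (f - g))].
apply: (@roots_geq_poly_eq0 _ _ s).
- by apply/allP => x _; rewrite /root hornerD hornerN fg subrr.
- by rewrite map_inj_uniq ?iota_uniq // => i j /eqP; rewrite eqr_nat => /eqP.
- by rewrite size_map size_iota.
Qed.

Lemma monotone_roots_eq (R : realType) p (f g : 'I_p -> R) :
  (forall i j : 'I_p, (i <= j)%N -> f i <= f j) ->
  (forall i j : 'I_p, (i <= j)%N -> g i <= g j) ->
  (forall x, \prod_i (x - f i) = \prod_i (x - g i)) -> f =1 g.
Proof.
move=> mf mg fg.
have prodE (h : 'I_p -> R) :
    \prod_(x <- map h (enum 'I_p)) ('X - x%:P) = \prod_i ('X - (h i)%:P).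
  by rewrite big_map big_enum.
have sortedE (h : 'I_p -> R) : (forall i j : 'I_p, (i <= j)%N -> h i <= h j) ->
    sorted <=%R (map h (enum 'I_p)).
  move=> mh; rewrite sorted_map; apply: (@sub_sorted _ (fun i j : 'I_p => (i <= j)%N)).
    by move=> i j; exact: mh.
  have := iota_sorted 0 p; rewrite -val_enum_ord sorted_map.
  exact: sub_sorted.
have pq : perm_eq (map f (enum 'I_p)) (map g (enum 'I_p)).
  apply: prod_XsubC_eq; rewrite !prodE; apply: eq_poly_horner => x.
  rewrite !horner_prod; under eq_bigr do rewrite hornerXsubC.
  by rewrite fg; apply: eq_bigr => i _; rewrite hornerXsubC.
have /eq_in_map h := sorted_eq le_trans le_anti (sortedE _ mf) (sortedE _ mg) pq.
by move=> i; apply: h; rewrite mem_enum.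
Qed.

Section FloquetBands.
Variables (R : realType) (p : nat) (V : int -> R).
Local Notation C := R[i].
Local Notation nc := (@Normc.normc R).
Local Notation q := p.+1.
Variables (lam : R -> 'I_q -> R) (Psi : R -> 'I_q -> 'cV[C]_q).
Hypothesis es : forall k, eigensystem (floquet V q k) (lam k) (Psi k).

Local Notation phase k := (q%:R * k).

Lemma floquet_ring_mx (k : R) (z : C) :
  z%:M - floquet V q k =
  ring_mx (fun i => z - (V (site i))%:C%C) (cis (phase k)) (cis (- phase k)).
Proof.
apply/matrixP => i j; rewrite !mxE /cis cosN sinN.
by case: (i == j); rewrite ?mulr1n ?mulr0n; ring.
Qed.

Lemma floquet_discriminant :
  exists D : C -> C, forall z k,
    \prod_j (z - (lam k j)%:C%C) = D z - (2 * cos (phase k))%:C%C.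
Proof.
have /choice[D DE] : forall z, exists d, forall k,
    \prod_j (z - (lam k j)%:C%C) = d - (2 * cos (phase k))%:C%C.
  move=> z; have [d dE] := det_ring_mx (fun i : 'I_q => z - (V (site i))%:C%C).
  exists d => k; rewrite -(det_eigen (es k)) floquet_ring_mx dE -?cisDN; first ring.
  by rewrite -cisD subrr cis0.
by exists D.
Qed.

Lemma floquet_minor (m : 'I_q) : exists mu : 'I_p -> R,
  (forall z k, cofactor (z%:M - floquet V q k) m m = \prod_i (z - (mu i)%:C%C))
  /\ forall k i, lam k (widen_ord (leqnSn p) i) <= mu i <= lam k (lift ord0 i).
Proof.
pose B k := row' m (col' m (floquet V q k)).
have /choice[mu muE] : forall k, exists mu, exists Phi, eigensystem (B k) mu Phi.
  move=> k; apply: eigensystem_exists; apply/is_hermitianmxP.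
  rewrite expr0 scale1r; apply/matrixP => i j.
  have /is_hermitianmxP := floquet_hermitian V q k; rewrite expr0 scale1r.
  by move=> /matrixP /(_ (lift m i) (lift m j)); rewrite !mxE.
have cofE z k : cofactor (z%:M - floquet V q k) m m = \prod_i (z - (mu k i)%:C%C).
  have [Phi esB] := muE k; rewrite -(det_eigen esB) /cofactor addnn -signr_odd odd_double.
  rewrite expr0 mul1r; congr (\det _); apply/matrixP => i j.
  by rewrite !mxE (inj_eq lift_inj).
have mu0 k : mu k =1 mu 0.
  have [Phi [m1 _ _]] := muE k; have [Phi' [m2 _ _]] := muE 0.
  apply: monotone_roots_eq => // x; apply: complexI; rewrite !rmorph_prod /=.
  under eq_bigr do rewrite rmorphB /=.
  under [RHS]eq_bigr do rewrite rmorphB /=.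
  rewrite -!cofE !floquet_ring_mx.
  have [a aE] := cofactor_ring_mx (fun i : 'I_q => x%:C%C - (V (site i))%:C%C) m.
  by rewrite !aE // -cisD subrr cis0.
exists (mu 0); split=> [z k|k i].
  by rewrite cofE; apply: eq_bigr => i _; rewrite mu0.
have [Phi esB] := muE k.
by rewrite -(mu0 k) (cauchy_interlacing_le (es k) esB) (cauchy_interlacing_ge (es k) esB).
Qed.

Lemma bands_ordered (l j : 'I_q) k k' : (l < j)%N -> lam k l <= lam k' j.
Proof.
move=> lj; have [mu [_ inter]] := floquet_minor ord0.
have lp : (l < p)%N by have := ltn_ord j; lia.
have /andP[+ _] := inter k (Ordinal lp); have /andP[_ +] := inter k' (Ordinal lp).
have [mono _ _] := es k'.
rewrite (_ : widen_ord _ _ = l); last exact: val_inj.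
move=> h1 h2; apply: le_trans h2 _; apply: le_trans h1 _; apply: mono.
by rewrite lift0.
Qed.

End FloquetBands.

(** * Real-rooted polynomials on a band *)

Section RealRooted.
Variable R : realType.
Local Notation C := R[i].
Local Notation nc := (@Normc.normc R).

Lemma bernoulli (y : R) n : 0 <= y <= 1 -> 1 - n%:R * y <= (1 - y) ^+ n.
Proof.
move=> /andP[y0 y1]; elim: n => [|n IH]; first by rewrite expr0 mul0r subr0.
rewrite exprS -natr1; apply: (@le_trans _ _ ((1 - y) * (1 - n%:R * y))).
  by have n0 : 0 <= (n%:R : R) by []; nra.
by rewrite ler_wpM2l // subr_ge0.
Qed.

Lemma prod_mulX n (f : 'I_n -> R) c : (\prod_l f l) * c ^+ n = \prod_l (f l * c).
Proof. by rewrite big_split /= prodr_const card_ord. Qed.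

Lemma ncB_real (x y r : R) : nc ((x +i* y)%C - r%:C%C) = Num.sqrt ((x - r) ^+ 2 + y ^+ 2).
Proof. by rewrite /= subr0. Qed.

Lemma nc_prodB_ge (I : finType) (P : pred I) (x y : R) (r : I -> R) :
  \prod_(i | P i) `|x - r i| <= \prod_(i | P i) nc ((x +i* y)%C - (r i)%:C%C).
Proof.
apply: ler_prod => i _; rewrite normr_ge0 ncB_real -sqrtr_sqr ler_wsqrtr //.
by rewrite lerDl sqr_ge0.
Qed.

Lemma betweenP (x e1 e2 : R) : (x - e1) * (x - e2) < 0 ->
  (e1 < x /\ x < e2) \/ (e2 < x /\ x < e1).
Proof.
have [x1|x1|->] := ltgtP x e1; last by rewrite subrr mul0r ltxx.
  by rewrite nmulr_rlt0 ?subr_lt0 // subr_gt0; right.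
by rewrite pmulr_rlt0 ?subr_gt0 // subr_lt0; left.
Qed.

Definition outside (e1 e2 r : R) := (r <= e1) && (r <= e2) || (e1 <= r) && (e2 <= r).

Lemma outsideC e1 e2 r : outside e1 e2 r = outside e2 e1 r.
Proof. by rewrite /outside andbC [(e1 <= r) && _]andbC. Qed.

Lemma outside_dist x e1 e2 r : (x - e1) * (x - e2) < 0 -> outside e1 e2 r ->
  `|e2 - r| * `|x - e1| <= `|x - r| * `|e2 - e1|.
Proof.
wlog e12 : x e1 e2 r / e1 < e2.
  move=> wl xe out; have [e12|e21|e12] := ltgtP e1 e2; first exact: wl.
    have := wl (- x) (- e1) (- e2) (- r); rewrite !opprK ltrN2 => /(_ e21).
    have -> : - x + e1 = - (x - e1) by ring.
    have -> : - x + e2 = - (x - e2) by ring.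
    have -> : - e2 + r = - (e2 - r) by ring.
    have -> : - x + r = - (x - r) by ring.
    have -> : - e2 + e1 = - (e2 - e1) by ring.
    by rewrite mulrNN !normrN; apply => //; rewrite /outside !lerN2 orbC.
  by rewrite e12 -expr2 ltNge sqr_ge0 in xe.
move=> xe out; have [[x1 x2]|[x1 x2]] := betweenP xe; last by lra.
move: out => /orP[] /andP[r1 r2].
  rewrite !ger0_norm; [|lra..].
  have : 0 <= (e1 - r) * (e2 - x) by apply: mulr_ge0; lra.
  lra.
rewrite (ler0_norm (_ : e2 - r <= 0)); last by lra.
rewrite (ler0_norm (_ : x - r <= 0)); last by lra.
rewrite !ger0_norm; [|lra..].
have : 0 <= (r - e1) * (e2 - x) by apply: mulr_ge0; lra.
lra.
Qed.

Lemma between_distD (x e1 e2 : R) : (x - e1) * (x - e2) < 0 ->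
  `|e2 - e1| = `|x - e1| + `|x - e2|.
Proof.
move=> /betweenP[[? ?]|[? ?]].
  rewrite (ltr0_norm (_ : x - e2 < 0)); last by lra.
  by rewrite (gtr0_norm (_ : 0 < x - e1)) ?gtr0_norm; lra.
rewrite (ltr0_norm (_ : x - e1 < 0)); last by lra.
by rewrite (ltr0_norm (_ : e2 - e1 < 0)) ?gtr0_norm; lra.
Qed.

Lemma edge_distance p (r : 'I_p.+1 -> R) x e1 e2 :
  (x - e1) * (x - e2) < 0 -> (forall l, outside e1 e2 (r l)) ->
  `|\prod_l (e2 - r l)| = 4 -> `|\prod_l (x - r l)| = 2 ->
  `|e2 - e1| <= 2 * p.+1%:R * `|x - e2|.
Proof.
move=> xe out; rewrite !normr_prod => P4 P2.
set l := `|e2 - e1|; set s := `|x - e2|.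
have lE : l = `|x - e1| + s by exact: between_distD.
have x1 : 0 < `|x - e1|.
  by rewrite normr_gt0; apply/eqP => h; rewrite h mul0r ltxx in xe.
have s0 : 0 <= s by exact: normr_ge0.
have l0 : 0 < l by lra.
have h : 4 * `|x - e1| ^+ p.+1 <= 2 * l ^+ p.+1.
  rewrite -P4 -P2 !prod_mulX.
  apply: ler_prod => i _; rewrite mulr_ge0 ?normr_ge0 //=.
  exact: outside_dist.
have /bernoulli b : 0 <= s / l <= 1.
  by rewrite divr_ge0 ?(ltW l0) //= ler_pdivrMr // mul1r lE lerDr normr_ge0.
have := b p.+1.
have -> : 1 - s / l = `|x - e1| / l by rewrite lE; field; rewrite -lE gt_eqF.
rewrite expr_div_n ler_pdivlMr ?exprn_gt0 // => b'.
have ln0 : 0 < l ^+ p.+1 by rewrite exprn_gt0.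
have : (1 - p.+1%:R * (s / l)) <= 1 / 2.
  by rewrite -(ler_pM2r ln0); lra.
rewrite mulrA => h2; have : 1 / 2 <= p.+1%:R * s / l by lra.
by rewrite ler_pdivlMr //; lra.
Qed.

(* On an interval free of roots, the modulus of a real-rooted polynomial is
   log-concave: the ratio of its values at a and at x is at most
   exp ((a - x) * S), S the logarithmic derivative at x. *)
Lemma prod_quasiconcave (I : finType) (P : pred I) (r : I -> R) x e1 e2 :
  (x - e1) * (x - e2) < 0 -> (forall l, P l -> outside e1 e2 (r l)) ->
  \prod_(l | P l) `|e1 - r l| <= \prod_(l | P l) `|x - r l|
  \/ \prod_(l | P l) `|e2 - r l| <= \prod_(l | P l) `|x - r l|.
Proof.
move=> xe out; pose S := \sum_(l | P l) (x - r l)^-1.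
have le a : (a = e1) \/ (a = e2) -> (a - x) * S <= 0 ->
    \prod_(l | P l) `|a - r l| <= \prod_(l | P l) `|x - r l|.
  move=> ae aS; apply: (@le_trans _ _ (\prod_(l | P l) (`|x - r l| * expR ((a - x) / (x - r l))))).
    apply: ler_prod => l Pl; rewrite normr_ge0 /=.
    have := out _ Pl; set t := r l => o.
    have xt : x - t != 0.
      by apply/eqP => h; move: o => /orP[] /andP[]; nra.
    have at0 : 0 <= (a - t) / (x - t).
      have : 0 <= (a - t) * (x - t).
        have [[? ?]|[? ?]] := betweenP xe.
          by move: o => /orP[] /andP[]; case: ae => ->; nra.
        by move: o => /orP[] /andP[]; case: ae => ->; nra.
      have -> : (a - t) / (x - t) = (a - t) * (x - t) * (x - t)^-1 ^+ 2 by field.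
      by move=> h; rewrite mulr_ge0 // sqr_ge0.
    have -> : `|a - t| = `|x - t| * ((a - t) / (x - t)).
      by rewrite -[X in _ = _ * X](ger0_norm at0) -normrM mulrC divfK.
    rewrite ler_wpM2l ?normr_ge0 // (le_trans _ (expR_ge1Dx _)) //.
    by rewrite le_eqVlt; apply/orP; left; apply/eqP; field; exact: xt.
  rewrite big_split /= -[leRHS]mulr1 ler_wpM2l ?prodr_ge0 //.
  by rewrite -expR_sum -mulr_sumr expR_le1.
have [S0|S0] := leP 0 ((e1 - x) * S); last by left; apply: le => //; [left|exact: ltW].
right; apply: le; first by right.
have [[x1 x2]|[x1 x2]] := betweenP xe.
  rewrite nmulr_rge0 ?subr_lt0 // in S0.
  by rewrite mulr_ge0_le0 // subr_ge0 ltW.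
rewrite pmulr_rge0 ?subr_gt0 // in S0.
by rewrite mulr_le0_ge0 // subr_le0 ltW.
Qed.


Lemma nc_shift_real (x y d r th : R) : 0 <= th <= 1 ->
  `|d| <= th * `|x - r| ->
  (1 - th) * nc ((x +i* y)%C - r%:C%C) <= nc (((x + d) +i* y)%C - r%:C%C).
Proof.
move=> /andP[t0 t1] dx; have t1' : 0 <= 1 - th by lra.
rewrite !ncB_real -[X in X * _](ger0_norm t1') -sqrtr_sqr -sqrtrM ?sqr_ge0 //.
apply: ler_wsqrtr; rewrite mulrDr lerD //.
  rewrite -exprMn -[leRHS]real_normK ?num_real // -[leLHS]real_normK ?num_real // lerXn2r ?nnegrE ?normr_ge0 //.
  rewrite normrM (ger0_norm t1') addrAC mulrBl mul1r.
  have := lerB_normD (x - r) d; rewrite -?lerBlDr; lra.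
by rewrite ler_piMl ?sqr_ge0 // expr_le1 //; lra.
Qed.

Lemma nc_shift_imag (x y r del : R) : 0 < del -> del <= `|x - r| ->
  nc ((x +i* y)%C - r%:C%C) <= `|x - r| * (1 + y ^+ 2 / (2 * del ^+ 2)).
Proof.
move=> d0 dx; have a0 : 0 < `|x - r| by exact: lt_le_trans dx.
have u0 : 0 <= y ^+ 2 / (2 * del ^+ 2) by rewrite divr_ge0 ?sqr_ge0 // mulr_ge0 ?sqr_ge0.
rewrite ncB_real -[leRHS]ger0_norm; last by rewrite mulr_ge0 // addr_ge0.
rewrite -sqrtr_sqr ler_wsqrtr //.
rewrite exprMn real_normK ?num_real //; set t := y ^+ 2 / _ in u0 *.
have A0 : 0 <= (x - r) ^+ 2 by exact: sqr_ge0.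
have dA : del ^+ 2 <= (x - r) ^+ 2.
  by rewrite -[leRHS]real_normK ?num_real // lerXn2r ?nnegrE // ltW.
have yE : y ^+ 2 = 2 * t * del ^+ 2 by rewrite /t; field; rewrite gt_eqF.
have : 2 * t * del ^+ 2 <= 2 * t * (x - r) ^+ 2 by rewrite ler_wpM2l // mulr_ge0.
have : 0 <= (x - r) ^+ 2 * t ^+ 2 by rewrite mulr_ge0 ?sqr_ge0.
have -> : (x - r) ^+ 2 * (1 + t) ^+ 2
  = (x - r) ^+ 2 + 2 * t * (x - r) ^+ 2 + (x - r) ^+ 2 * t ^+ 2 by ring.
rewrite yE; lra.
Qed.

Variables (p : nat) (D : C -> C) (e a b : 'I_p.+1 -> R) (mu : 'I_p -> R) (j : 'I_p.+1).
Local Notation q := (p.+1%:R : R).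
Hypothesis De : forall z, \prod_l (z - (e l)%:C%C) = D z.
Hypothesis Da : forall z, \prod_l (z - (a l)%:C%C) = D z - 2.
Hypothesis Db : forall z, \prod_l (z - (b l)%:C%C) = D z + 2.
Hypothesis same_side : forall l, l != j -> 0 <= (e j - a l) * (e j - b l).
Hypothesis e_out : forall l, l != j -> outside (a j) (b j) (e l).
Hypothesis a_out : forall l, l != j -> outside (a j) (b j) (a l).
Hypothesis b_out : forall l, l != j -> outside (a j) (b j) (b l).
Hypothesis mu_out : forall i, outside (a j) (b j) (mu i).

Let width := `|b j - a j|.

Let prod_real (x : R) (r : 'I_p.+1 -> R) :
  \prod_l (x%:C%C - (r l)%:C%C) = (\prod_l (x - r l))%:C%C.
Proof. by rewrite rmorph_prod; apply: eq_bigr => l _; rewrite rmorphB. Qed.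

Let root_prod x (r : 'I_p.+1 -> R) l : x = r l -> \prod_l (x - r l) = 0.
Proof. by move=> ->; rewrite (bigD1 l) //= subrr mul0r. Qed.

Let prod_ab x : \prod_l (x - a l) = \prod_l (x - b l) - 4.
Proof.
apply: complexI; rewrite rmorphB /= -!prod_real Da Db rmorph_nat.
ring.
Qed.

Let prod_eb x : \prod_l (x - e l) = \prod_l (x - b l) - 2.
Proof. by apply: complexI; rewrite rmorphB /= -!prod_real De Db rmorph_nat; ring. Qed.

Let Eb : \prod_l (e j - b l) = 2.
Proof. by have := prod_eb (e j); rewrite (@root_prod _ e j) //; lra. Qed.

Let Ea : \prod_l (e j - a l) = -2.
Proof. by rewrite prod_ab Eb; ring. Qed.

Let between : (e j - a j) * (e j - b j) < 0.
Proof.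
have : \prod_l ((e j - a l) * (e j - b l)) = -4 by rewrite big_split /= Ea Eb; ring.
rewrite (bigD1 j) //=; set P := \prod_(_ | _) _ => h.
have P0 : 0 <= P by apply: prodr_ge0 => l lj; exact: same_side.
rewrite ltNge; apply/negP => h'; have := mulr_ge0 h' P0; lra.
Qed.

Let aj_out : outside (a j) (b j) (a j).
Proof. by rewrite /outside lexx /= -implyNb -ltNge; apply/implyP => /ltW. Qed.

Let bj_out : outside (a j) (b j) (b j).
Proof. by rewrite /outside lexx !andbT orbC -implyNb -ltNge; apply/implyP => /ltW. Qed.

Let a_out' l : outside (a j) (b j) (a l).
Proof. by have [->|/a_out] := eqVneq l j. Qed.

Let b_out' l : outside (a j) (b j) (b l).
Proof. by have [->|/b_out] := eqVneq l j. Qed.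

Let width_le_b : width <= 2 * q * `|e j - b j|.
Proof.
apply: (edge_distance between a_out').
  by rewrite prod_ab (@root_prod _ b j) // sub0r normrN ger0_norm.
by rewrite Ea normrN ger0_norm.
Qed.

Let width_le_a : width <= 2 * q * `|e j - a j|.
Proof.
rewrite /width distrC; apply: (@edge_distance _ b _ (b j)).
- by rewrite mulrC.
- by move=> l; rewrite outsideC.
- have := prod_ab (a j); rewrite (@root_prod _ a j) // => h.
  have -> : \prod_l (a j - b l) = 4 by lra.
  by rewrite ger0_norm.
- by rewrite Eb ger0_norm.
Qed.

Lemma width_gt0 : 0 < width.
Proof.
rewrite /width (between_distD between) ltr_wpDr // normr_gt0.
by apply/eqP => h; have := between; rewrite h mul0r ltxx.
Qed.

Let width_le r : outside (a j) (b j) r -> width <= 2 * q * `|e j - r|.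
Proof.
have q0 : 0 <= 2 * q by rewrite mulr_ge0.
have near t : `|e j - t| <= `|e j - r| -> width <= 2 * q * `|e j - t| -> width <= 2 * q * `|e j - r|.
  by move=> h w; apply: le_trans w _; rewrite ler_wpM2l.
have [[x1 x2]|[x1 x2]] := betweenP between; move=> /orP[] /andP[r1 r2].
- by apply: (near (a j)) => //; rewrite !ger0_norm; lra.
- by apply: (near (b j)) => //; rewrite !ler0_norm; lra.
- by apply: (near (b j)) => //; rewrite !ger0_norm; lra.
- by apply: (near (a j)) => //; rewrite !ler0_norm; lra.
Qed.

Lemma derivative_lower_bound : 2 <= width * \prod_(l | l != j) `|e j - e l|.
Proof.
have ge t : \prod_l `|t - e l| = 2 -> `|t - e j| <= width ->
    \prod_(l | l != j) `|t - e l| <= \prod_(l | l != j) `|e j - e l| ->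
    2 <= width * \prod_(l | l != j) `|e j - e l|.
  move=> <- tw h; rewrite (bigD1 j) //= ler_pM //.
  by apply: prodr_ge0.
have wE := between_distD between.
have [h|h] := prod_quasiconcave between e_out.
  apply: (ge (a j)) => //.
    rewrite -normr_prod prod_eb; have := prod_ab (a j); rewrite (@root_prod _ a j) // => h'.
    by rewrite (_ : _ - _ = 2) ?ger0_norm //; lra.
  by rewrite distrC /width wE lerDl.
apply: (ge (b j)) => //.
  by rewrite -normr_prod prod_eb (@root_prod _ b j) // sub0r normrN ger0_norm.
by rewrite distrC /width wE lerDr.
Qed.

Variables (x eps : R).
Hypothesis x_small : 0 <= x <= width / (4 * q ^+ 2).
Hypothesis eps0 : 0 < eps.


Let x_le r : outside (a j) (b j) r -> x <= 1 / (2 * q) * `|e j - r|.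
Proof.
have /andP[x0 xw] := x_small; move=> /width_le h.
have q1 : 1 <= q by rewrite ler1n.
have q0 : 0 < q by lra.
apply: le_trans xw _; rewrite ler_pdivrMr; last by rewrite mulr_gt0 ?exprn_gt0.
by rewrite (le_trans h) // le_eqVlt; apply/orP; left; apply/eqP; field; rewrite gt_eqF.
Qed.

Let shift_ge r : outside (a j) (b j) r -> width / (4 * q) <= `|e j + x - r|.
Proof.
move=> o; have h := width_le o; have h' := x_le o; have /andP[x0 xw] := x_small.
have q1 : 1 <= q by rewrite ler1n.
have q0 : 0 < q by lra.
have : x <= 1 / 2 * `|e j - r|.
  apply: le_trans h' _; rewrite ler_wpM2r // ler_pdivrMr ?mulr_gt0 //; lra.
have : width / (4 * q) <= 1 / 2 * `|e j - r|.
  by rewrite ler_pdivrMr ?mulr_gt0 //; lra.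
have := lerB_normD (e j - r) x; rewrite (ger0_norm x0) [e j + x - r]addrAC.
move: (width / _) `|e j - r| `|e j - r + x| => ? ? ?; lra.
Qed.

Let prod_sign (r : 'I_p.+1 -> R) : (forall l, outside (a j) (b j) (r l)) ->
  0 <= (\prod_l (e j + x - r l)) * \prod_l (e j - r l).
Proof.
have q1 : 1 <= q by rewrite ler1n.
move=> o; rewrite -big_split /=; apply: prodr_ge0 => l _.
have /andP[x0 xw] := x_small; have := x_le (o l) => h.
have : x <= `|e j - r l|.
  apply: le_trans h _; rewrite ler_piMl // ler_pdivrMr ?mulr_gt0 //; lra.
have -> : (e j + x - r l) * (e j - r l) = (e j - r l) ^+ 2 + x * (e j - r l) by ring.
rewrite -real_normK ?num_real //; set n := `|_| => xn.
have : - n <= e j - r l by rewrite lerNl /n -[leRHS]normrN ler_norm.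
have : 0 <= n by exact: normr_ge0.
move: n xn (e j - r l) => n xn w n0 wn; have := mulr_ge0 n0 (_ : 0 <= n - x); nra.
Qed.

Let u := 8 * q ^+ 2 * eps ^+ 2 / width ^+ 2.

Lemma discriminant_bound :
  nc (D ((e j + x) +i* eps)%C - 2) + nc (D ((e j + x) +i* eps)%C + 2) <= 4 * (1 + u) ^+ p.+1.
Proof.
have q1 : 1 <= q by rewrite ler1n.
have q0 : 0 < q by lra.
have w0 := width_gt0.
have le (r : 'I_p.+1 -> R) : (forall l, outside (a j) (b j) (r l)) ->
    nc (\prod_l (((e j + x) +i* eps)%C - (r l)%:C%C)) <= `|\prod_l (e j + x - r l)| * (1 + u) ^+ p.+1.
  move=> o; rewrite nc_prod normr_prod prod_mulX.
  apply: ler_prod => l _; rewrite nc_ge0 /=.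
  have -> : u = eps ^+ 2 / (2 * (width / (4 * q)) ^+ 2).
    by rewrite /u; field; rewrite !gt_eqF.
  by apply: nc_shift_imag; [rewrite divr_gt0 ?mulr_gt0|exact: shift_ge].
rewrite -Da -Db; apply: le_trans (lerD (le _ a_out') (le _ b_out')) _.
have u0 : 0 <= u by rewrite divr_ge0 ?sqr_ge0 // mulr_ge0 ?sqr_ge0 // mulr_ge0 ?sqr_ge0.
rewrite -mulrDl ler_wpM2r ?exprn_ge0 ?addr_ge0 //.
have := prod_sign a_out'; have := prod_sign b_out'; rewrite Ea Eb prod_ab.
set t := \prod_l _ => t1 t2.
by rewrite ler0_norm ?ger0_norm; lra.
Qed.

Variable (phi : 'I_p.+1 -> R).
Hypothesis phi0 : forall l, 0 <= phi l.
Hypothesis resolvent : forall z, (forall l, z != (e l)%:C%C) ->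
  \prod_i (z - (mu i)%:C%C) = \prod_l (z - (e l)%:C%C) * \sum_l (phi l)%:C%C / (z - (e l)%:C%C).

Let minor_at_energy :
  2 * phi j <= width * nc (\prod_i ((e j +i* eps)%C - (mu i)%:C%C)).
Proof.
set z := (e j +i* eps)%C.
have zn l : z != (e l)%:C%C by rewrite eq_complex /= (gt_eqF eps0) andbF.
rewrite resolvent // Normc.normcM nc_prod (bigD1 j) //.
set S := \sum_l _.
have zj : nc (z - (e j)%:C%C) = eps.
  by rewrite ncB_real subrr expr0n add0r sqrtr_sqr gtr0_norm.
have ImS : complex.Im S = - \sum_l phi l * eps / ((e j - e l) ^+ 2 + eps ^+ 2).
  rewrite /S Im_sum -sumrN; apply: eq_bigr => l _.
  by rewrite /= !subr0; ring.
have S_ge : phi j / eps <= nc S.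
  apply: le_trans (Im_le_nc S); rewrite ImS normrN.
  have t0 l : 0 <= phi l * eps / ((e j - e l) ^+ 2 + eps ^+ 2).
    by rewrite divr_ge0 ?mulr_ge0 ?addr_ge0 ?sqr_ge0 // ltW.
  rewrite ger0_norm ?sumr_ge0 // (bigD1 j) //= ler_wpDr ?sumr_ge0 //.
  rewrite subrr expr0n add0r le_eqVlt; apply/orP; left; apply/eqP; field.
  by rewrite gt_eqF.
rewrite zj; set P := \prod_(_ | _) _.
have P_ge : \prod_(l | l != j) `|e j - e l| <= P by exact: nc_prodB_ge.
have w0 := width_gt0.
have d := derivative_lower_bound.
have P2 : 2 <= width * P by apply: le_trans d _; rewrite ler_pM2l.
have : phi j <= eps * nc S by rewrite -ler_pdivrMl // mulrC.
have := phi0 j.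
have -> : width * (eps * P * nc S) = (width * P) * (eps * nc S) by ring.
move=> h1 h2; apply: ler_pM => //.
Qed.

Lemma minor_lower_bound :
  phi j <= width * nc (\prod_i (((e j + x) +i* eps)%C - (mu i)%:C%C)).
Proof.
have q1 : 1 <= q by rewrite ler1n.
have q0 : 0 < q by lra.
set th := 1 / (2 * q).
have th01 : 0 <= th <= 1.
  by rewrite divr_ge0 ?mulr_ge0 ?(ltW q0) //= ler_pdivrMr ?mulr_gt0 //; lra.
have /andP[x0 _] := x_small.
have /andP[t0 t1] := th01.
have : (1 - th) ^+ p * nc (\prod_i ((e j +i* eps)%C - (mu i)%:C%C))
    <= nc (\prod_i (((e j + x) +i* eps)%C - (mu i)%:C%C)).
  rewrite !nc_prod mulrC prod_mulX.
  apply: ler_prod => i _; rewrite mulrC mulr_ge0 ?nc_ge0 ?subr_ge0 //=.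
  by apply: nc_shift_real => //; rewrite ger0_norm // x_le.
have : 1 / 2 <= (1 - th) ^+ p.
  apply: le_trans (bernoulli p th01).
  have : p%:R * th <= q * th by rewrite ler_wpM2r // ler_nat.
  have -> : q * th = 1 / 2 by rewrite /th; field; rewrite gt_eqF.
  by lra.
have := minor_at_energy; set A := nc _; set B := nc _ => h1 h2 h3.
have A0 : 0 <= A by exact: nc_ge0.
have h4 : 1 / 2 * A <= B by apply: le_trans h3; rewrite ler_wpM2r.
have w0 := width_gt0.
have : width * (1 / 2 * A) <= width * B by rewrite ler_pM2l.
by lra.
Qed.

End RealRooted.

(** * The Floquet multiplier and the Green function of a finite ring *)

Section RootsOfUnity.
Variable R : realType.
Local Notation C := R[i].
Local Notation nc := (@Normc.normc R).

Lemma cis_2pi (a : int) : cis (2 * pi * a%:~R : R) = 1.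
Proof.
have cis2pi : cis (2 * pi : R) = 1 by rewrite /cis mulr_natl cos2pi sin2pi.
case: a => n; first by rewrite [_ * _]mulrC -cisX cis2pi expr1n.
by rewrite NegzE mulrNz mulrN cisN -pmulrn [_ * _%:R]mulrC -cisX cis2pi expr1n invr1.
Qed.

Lemma cis_neq1 (x : R) : 0 < x < 2 * pi -> cis x != 1.
Proof.
move=> /andP[x0 x1]; rewrite eq_complex /=; apply/negP => /andP[/eqP c _].
have : 0 < sin (x / 2) by apply: sin_gt0_pi; apply/andP; split; lra.
have := cosD (x / 2) (x / 2); rewrite -splitr c.
have := cos2Dsin2 (x / 2); set s := sin _; set t := cos _ => h1 h2 s0.
have : s ^+ 2 = 0 by move: h1 h2; rewrite !expr2; lra.
by move/eqP; rewrite sqrf_eq0 gt_eqF.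
Qed.

Definition angle N (r : nat) : R := 2 * pi * r%:R / N%:R.

Lemma sum_roots_of_unity N (m : int) : (0 < N)%N ->
  \sum_(r < N) cis (angle N r * m%:~R) = if (N %| m)%Z then N%:R else 0.
Proof.
move=> N0; have NR : (N%:R : R) != 0 by rewrite pnatr_eq0 -lt0n.
pose x := cis (2 * pi * m%:~R / N%:R : R).
have termE (r : nat) : cis (angle N r * m%:~R) = x ^+ r.
  by rewrite /x cisX; congr cis; rewrite /angle; field.
under eq_bigr do rewrite termE.
have xN : x ^+ N = 1.
  by rewrite /x cisX -[RHS](cis_2pi m); congr cis; field.
case: ifPn => [/dvdzP[a ma]|Nm].
  have -> : x = 1.
    rewrite /x -[RHS](cis_2pi a) ma intrM; congr cis; rewrite -pmulrn; field.
    by [].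
  by under eq_bigr do rewrite expr1n; rewrite sumr_const card_ord.
have x1 : x != 1.
  have NZ : N%:Z != 0 by rewrite eqz_nat -lt0n.
  have -> : x = cis (2 * pi * ((m %% N)%Z)%:~R / N%:R).
    rewrite /x {1}(divz_eq m N) intrD intrM -pmulrn.
    have -> : 2 * pi * ((m %/ N)%Z%:~R * N%:R + (m %% N)%Z%:~R) / N%:R
      = 2 * pi * (m %/ N)%Z%:~R + 2 * pi * (m %% N)%Z%:~R / N%:R :> R by field.
    by rewrite cisD cis_2pi mul1r.
  have b0 : (0 < (m %% N)%Z).
    by rewrite lt_neqAle modz_ge0 // andbT eq_sym; apply: contra Nm => /eqP/dvdz_mod0P.
  have bN : ((m %% N)%Z < N%:Z) by rewrite ltz_pmod.
  apply: cis_neq1; have p0 := pi_gt0 R; have N0' : (0 : R) < N%:R by rewrite ltr0n.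
  apply/andP; split; first by rewrite divr_gt0 // mulr_gt0 ?mulr_gt0 ?ltr0z.
  rewrite ltr_pdivrMr // ltr_pM2l ?mulr_gt0 // pmulrn ltr_int //.
have := subrX1 x N; rewrite xN subrr => /esym/eqP.
by rewrite mulf_eq0 subr_eq0 (negbTE x1) => /eqP.
Qed.

Lemma exists_decaying_multiplier (d : C) : (forall k, d != (2 * cos k)%:C%C) ->
  exists w, [/\ w != 0, nc w < 1 & d = w + w^-1].
Proof.
move=> dn; pose s := sqrtC (d ^+ 2 - 4).
have ss : s ^+ 2 = d ^+ 2 - 4 by exact: sqrtCK.
pose w1 := (d + s) / 2; pose w2 := (d - s) / 2.
have w12 : w1 * w2 = 1.
  have -> : w1 * w2 = (d ^+ 2 - s ^+ 2) / 4 by rewrite /w1 /w2; field.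
  by rewrite ss; field.
have dE : d = w1 + w2 by rewrite /w1 /w2; field.
have w10 : w1 != 0 by apply/eqP => h; have /eqP := w12; rewrite h mul0r eq_sym oner_eq0.
have w20 : w2 != 0 by apply/eqP => h; have /eqP := w12; rewrite h mulr0 eq_sym oner_eq0.
have w2E : w2 = w1^-1 by apply: (mulfI w10); rewrite w12 mulfV.
have [h|h|h] := ltgtP (nc w1) 1.
- by exists w1; rewrite w10 h dE w2E.
- exists w2; rewrite w20 w2E invrK addrC -w2E -dE; split=> //.
  by rewrite w2E Normc.normcV invf_lt1 // (lt_trans _ h).
have w2J : w2 = w1^*.
  by apply: (mulfI w10); rewrite w12 mul_conjE h expr1n.
have r1 : -1 <= complex.Re w1 <= 1.
  by rewrite -ler_norml -h Re_le_nc.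
have := dn (acos (complex.Re w1)); rewrite acosK ?in_itv //.
rewrite dE w2J conjCE; case: (w1) => x y /=.
by rewrite eq_complex /= subrr eqxx andbT mulr2n mulrDl mul1r eqxx.
Qed.

Lemma multiplier_modulus (d w : C) : w != 0 -> d = w + w^-1 ->
  nc (d - 2) + nc (d + 2) = 2 * (nc w + (nc w)^-1).
Proof.
move=> w0 ->; have nw : nc w != 0 by rewrite nc_eq0.
have -> : w + w^-1 - 2 = (w - 1) ^+ 2 / w by field.
have -> : w + w^-1 + 2 = (w + 1) ^+ 2 / w by field.
have e z : nc (z ^+ 2 / w) = nc z ^+ 2 / nc w by rewrite Normc.normcM ncX Normc.normcV.
rewrite !e -mulrDl !nc_sqr.
have -> : 2 * (nc w + (nc w)^-1) = 2 * (nc w ^+ 2 + 1) / nc w by field.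
by congr (_ / _); rewrite nc_sqr; case: (w) => x y /=; ring.
Qed.

Lemma multiplier_power_bound (y u : R) q n : 0 < y <= 1 -> 0 <= u -> (0 < n)%N ->
  y + y^-1 <= 2 * (1 + u) ^+ q -> 64 * q%:R * u * n%:R ^+ 2 <= 1 ->
  1 / 2 <= y ^+ n /\ y + y^-1 <= 4.
Proof.
move=> /andP[y0 y1] u0 n0 yu small.
have n1 : 1 <= n%:R :> R by rewrite ler1n.
have qu0 : 0 <= q%:R * u by rewrite mulr_ge0.
have small' : q%:R * u <= 1 / (64 * n%:R ^+ 2).
  by rewrite ler_pdivlMr ?mulr_gt0 ?exprn_gt0 ?ltr0n //; lra.
have n2 : 1 <= n%:R ^+ 2 :> R by rewrite expr_ge1.
have qu64 : 64 * (q%:R * u) <= 1.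
  apply: le_trans small; rewrite -!mulrA ler_wpM2l // mulrA ler_peMr //.
have X : (1 + u) ^+ q <= 1 + 2 * (q%:R * u).
  have [->|q0] := posnP q; first by rewrite expr0 mul0r mulr0 addr0.
  have u1 : u <= 1.
    have : u <= q%:R * u by rewrite ler_peMl // ler1n.
    lra.
  have b := @bernoulli R u q; rewrite u0 u1 in b; have {}b := b isT.
  have : (1 + u) ^+ q * (1 - u) ^+ q <= 1.
    rewrite -exprMn exprn_ile1 //; first by rewrite mulr_ge0; lra.
    by nra.
  have X0 : 0 <= (1 + u) ^+ q by rewrite exprn_ge0 ?addr_ge0.
  move: ((1 + u) ^+ q) ((1 - u) ^+ q) (q%:R * u) qu0 qu64 b X0 => a b c c0 c1 h a0 ab.
  have : a * (1 - c) <= 1 by nra.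
  by nra.
have ysq : (1 - y) ^+ 2 <= 4 * (q%:R * u).
  have : y ^+ 2 + 1 <= y * (2 + 4 * (q%:R * u)).
    have := yu; rewrite -(ler_pM2l y0) mulrDr divff ?gt_eqF // => h.
    have : y * (2 * (1 + u) ^+ q) <= y * (2 + 4 * (q%:R * u)) by rewrite ler_pM2l //; lra.
    by rewrite expr2; lra.
  have := mulr_ge0 (_ : 0 <= 1 - y) qu0; rewrite subr_ge0 => /(_ y1).
  by nra.
split; last by lra.
have yn : 1 - y <= 1 / (4 * n%:R).
  rewrite -(ler_pXn2r (_ : 0 < 2)%N) ?nnegrE ?subr_ge0 ?divr_ge0 ?mulr_ge0 //.
  apply: le_trans ysq _; rewrite expr_div_n expr1n exprMn.
  have -> : 1 / (4 ^+ 2 * n%:R ^+ 2) = 4 * (1 / (64 * n%:R ^+ 2)) :> R.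
    by field; rewrite gt_eqF //; lra.
  by rewrite ler_pM2l.
have := @bernoulli R (1 - y) n; rewrite subr_ge0 y1 /= lerBlDr lerDl (ltW y0) => /(_ isT).
have -> : 1 - (1 - y) = y by ring.
move=> h; apply: le_trans h; have : n%:R * (1 - y) <= n%:R * (1 / (4 * n%:R)).
  by rewrite ler_wpM2l.
have -> : n%:R * (1 / (4 * n%:R)) = 1 / 4 :> R by field; rewrite gt_eqF //; lra.
by lra.
Qed.

Lemma discrete_green_function N n (w : C) : (0 < n < N)%N -> w != 0 -> nc w < 1 ->
  N%:R^-1 * \sum_(r < N) cis (- (angle N r * n%:R))
     / (w + w^-1 - (2 * cos (angle N r))%:C%C)
  = (w ^+ n + w ^+ (N - n)) / ((1 - w ^+ N) * (w^-1 - w)).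
Proof.
move=> /andP[n0 nN] w0 w1.
have N0 : (0 < N)%N by lia.
have NR : (N%:R : C) != 0 by rewrite pnatr_eq0 -lt0n.
have neq1 z : nc z < 1 -> 1 - z != 0.
  by move=> z1; rewrite subr_eq0; apply/eqP => z1'; rewrite -z1' Normc.normc1 ltxx in z1.
have wN : 1 - w ^+ N != 0.
  by apply: neq1; rewrite ncX exprn_ilt1 ?nc_ge0 // -lt0n.
have ww : w^-1 - w != 0.
  have -> : w^-1 - w = (1 - w ^+ 2) / w by field.
  by rewrite mulf_neq0 ?invr_eq0 // neq1 // ncX exprn_ilt1 ?nc_ge0.
have geom z : nc z < 1 -> z ^+ N = w ^+ N -> \sum_(s < N) z ^+ s = (1 - w ^+ N) / (1 - z).
  move=> z1 zN; have nz := neq1 _ z1; apply: (mulIf nz); rewrite divfK // -zN.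
  by rewrite -[1 - z ^+ N]opprB subrX1; ring.
have cN (m : int) (r : nat) : cis (angle N r * m%:~R) ^+ N = 1 :> C.
  rewrite cisX -[RHS](cis_2pi (r%:Z * m)) intrM -pmulrn; congr cis.
  by rewrite /angle; field; rewrite pnatr_eq0 -lt0n.
have term (r : nat) : cis (- (angle N r * n%:R)) / (w + w^-1 - (2 * cos (angle N r))%:C%C)
    * ((1 - w ^+ N) * (w^-1 - w))
  = \sum_(s < N) w ^+ s * cis (angle N r * (s%:Z - n%:Z)%:~R)
    + \sum_(s < N) w ^+ s * cis (angle N r * (- (s%:Z + n%:Z))%:~R)
    - (1 - w ^+ N) * cis (angle N r * (- n%:Z)%:~R).
  set th := angle N r; set x := cis th; have x0 : x != 0 := cis_neq0 th.
  have xN : x ^+ N = 1 by have := cN 1 r; rewrite mulr1.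
  have nx : nc (w * x) < 1 by rewrite Normc.normcM nc_cis mulr1.
  have nx' : nc (w / x) < 1 by rewrite Normc.normcM Normc.normcV nc_cis invr1 mulr1.
  have e1 : \sum_(s < N) w ^+ s * cis (th * (s%:Z - n%:Z)%:~R)
      = cis (- (th * n%:R)) * \sum_(s < N) (w * x) ^+ s.
    rewrite mulr_sumr; apply: eq_bigr => s _.
    by rewrite exprMn cisX intrB -!pmulrn mulrBr cisD [_ * s%:R]mulrC; ring.
  have e2 : \sum_(s < N) w ^+ s * cis (th * (- (s%:Z + n%:Z))%:~R)
      = cis (- (th * n%:R)) * \sum_(s < N) (w / x) ^+ s.
    rewrite mulr_sumr; apply: eq_bigr => s _.
    rewrite expr_div_n cisX mulrNz intrD -!pmulrn mulrN mulrDr opprD cisD.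
    by rewrite [_ * s%:R]mulrC -cisN; ring.
  have e3 : cis (th * (- n%:Z)%:~R) = cis (- (th * n%:R)).
    by rewrite mulrNz -pmulrn mulrN.
  rewrite e1 e2 e3 geom // ?exprMn ?xN ?mulr1 // geom // ?exprVn ?xN ?invr1 ?mulr1 //.
  rewrite -cisDN (cisN th) -/x; have := neq1 _ nx; have := neq1 _ nx' => h1 h2.
  move: (cis (- (th * _))) (w ^+ N) => A B.
    have xw : x - w != 0.
      by have := mulf_neq0 x0 h1; rewrite mulrBr mulr1 mulrCA divff // mulr1.
    field; rewrite x0 xw h2 w0 /=.
    have -> : (w * w + 1) * x + - (x * x + 1) * w = (x - w) * (1 - w * x) by ring.
    exact: mulf_neq0.
  by rewrite expr_div_n xN divr1.
have swap (m : nat -> int) : \sum_(r < N) \sum_(s < N) w ^+ s * cis (angle N r * (m s)%:~R)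
    = \sum_(s < N) w ^+ s * (if (N %| m s)%Z then N%:R else 0).
  rewrite exchange_big; apply: eq_bigr => s _ /=.
  by rewrite -mulr_sumr sum_roots_of_unity.
have pick (m : nat -> int) (t : 'I_N) : (forall s : 'I_N, (N %| m s)%Z = (s == t)) ->
    \sum_(s < N) w ^+ s * (if (N %| m s)%Z then N%:R else 0) = w ^+ t * N%:R.
  move=> mt; rewrite (bigD1 t) //= mt eqxx big1 ?addr0 // => s /negbTE st.
  by rewrite mt st mulr0.
have Nn : (N - n < N)%N by lia.
apply: (mulIf (mulf_neq0 wN ww)); rewrite divfK ?mulf_neq0 // -mulrA mulr_suml.
under eq_bigr do rewrite term.
rewrite sumrB big_split /= (swap (fun s => s%:Z - n%:Z)) (swap (fun s => - (s%:Z + n%:Z))).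
rewrite -mulr_sumr sum_roots_of_unity // dvdzE abszN /= ifF; last first.
  by apply/negbTE; rewrite gtnNdvd.
rewrite (pick (fun s => s%:Z - n%:Z) (Ordinal nN)) => [|s]; last first.
  by rewrite -eqz_mod_dvd !modz_nat eqz_nat !modn_small.
rewrite (pick (fun s => - (s%:Z + n%:Z)) (Ordinal Nn)) => [|s]; last first.
  rewrite -PoszD dvdzE abszN /=; apply/dvdnP/eqP => [[[|[|k]]]|->] /=; first lia.
  - by rewrite mul1n => h; apply: val_inj => /=; lia.
  - by have := ltn_ord s; rewrite !mulSn; lia.
  - by exists 1%N; rewrite /=; lia.
by rewrite mulr0 subr0 -mulrDl mulrC mulfK.
Qed.

Lemma green_function_lower_bound N n (w : C) : (0 < n < N)%N -> w != 0 -> nc w < 1 ->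
  nc w ^+ (N - n) <= 1 / 2 * nc w ^+ n -> 
  nc w + (nc w)^-1 <= 4 ->
  nc w ^+ n / 16 <= nc (N%:R^-1 * \sum_(r < N) cis (- (angle N r * n%:R))
     / (w + w^-1 - (2 * cos (angle N r))%:C%C)).
Proof.
move=> nN w0 w1 small w4; rewrite discrete_green_function // Normc.normcM Normc.normcV.
have nw0 : 0 < nc w by rewrite lt_neqAle nc_ge0 eq_sym nc_eq0 w0.
have num : nc w ^+ n / 2 <= nc (w ^+ n + w ^+ (N - n)).
  have := nc_geB (w ^+ n) (w ^+ (N - n)); rewrite !ncX; lra.
have den : nc ((1 - w ^+ N) * (w^-1 - w)) <= 8.
  rewrite Normc.normcM (_ : 8 = 2 * 4); last by ring.
  apply: ler_pM; rewrite ?nc_ge0 //.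
    have := nc_leD 1 (- w ^+ N); rewrite ncN ncX Normc.normc1.
    have : nc w ^+ N <= 1 by rewrite exprn_ile1 ?nc_ge0 // ltW.
    by lra.
  by have := nc_leD w^-1 (- w); rewrite ncN Normc.normcV; lra.
have den0 : 0 < nc ((1 - w ^+ N) * (w^-1 - w)).
  rewrite lt_neqAle nc_ge0 eq_sym nc_eq0 andbT mulf_neq0 //.
    rewrite subr_eq0; apply/eqP => h; have : nc w ^+ N < 1.
      by rewrite exprn_ilt1 ?nc_ge0 // -lt0n; lia.
    by rewrite -ncX -h Normc.normc1 ltxx.
  rewrite subr_eq0; apply/eqP => h; have := congr1 nc h; rewrite Normc.normcV => h'.
  by have := w1; rewrite -h' invf_lt1 // => h2; have := lt_trans h2 w1; rewrite ltxx.
rewrite ler_pdivlMr //; apply: le_trans num.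
have : 0 <= nc w ^+ n by rewrite exprn_ge0 ?nc_ge0.
by nra.
Qed.

End RootsOfUnity.

(** * Bloch waves *)

Section Locality.
Variables (R : realType) (V : int -> R).
Local Notation C := R[i].
Local Notation nc := (@Normc.normc R).
Implicit Types psi : int -> C.

Lemma iter_schrodinger_local k psi1 psi2 x :
  (forall y, `|y - x| <= k%:Z -> psi1 y = psi2 y) ->
  iter k (schrodinger V) psi1 x = iter k (schrodinger V) psi2 x.
Proof.
elim: k x => [|k IH] x h; first by apply: h; rewrite subrr.
rewrite !iterS /schrodinger !IH // => y yx; apply: h; lia.
Qed.

Lemma iter_schrodinger_bound M psi k x : (forall n, `|V n| <= M) ->
  (forall y, nc (psi y) <= 1) -> nc (iter k (schrodinger V) psi x) <= (2 + M) ^+ k.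
Proof.
move=> VM psi1; elim: k x => [|k IH] x; first by rewrite expr0 /= psi1.
rewrite iterS exprS mulrDl /schrodinger (le_trans (nc_leD _ _)) // lerD //.
  by rewrite (le_trans (nc_leD _ _)) // mulr_natl mulr2n lerD.
by rewrite Normc.normcM nc_real ler_pM ?nc_ge0.
Qed.

Lemma iter_schrodinger_sum k N (c : 'I_N -> C) (psi : 'I_N -> int -> C) x :
  iter k (schrodinger V) (fun y => \sum_r c r * psi r y) x =
  \sum_r c r * iter k (schrodinger V) (psi r) x.
Proof.
elim: k x => [|k IH] x //; rewrite iterS /schrodinger !IH mulr_sumr -!big_split /=.
by apply: eq_bigr => r _; rewrite /schrodinger; ring.
Qed.

End Locality.

Section Bloch.
Variables (R : realType) (p : nat) (V : int -> R).
Local Notation C := R[i].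
Local Notation nc := (@Normc.normc R).
Local Notation q := p.+1.
Hypothesis Vq : periodic V q.

Definition cell (x : int) : int := ((x + (p./2)%:Z) %/ q%:Z)%Z.

Definition cell_index (x : int) : 'I_q := inord `|((x + (p./2)%:Z) %% q%:Z)%Z|%N.

Lemma cell_indexE x (n : int) (i : 'I_q) :
  x + (p./2)%:Z = n * q%:Z + i%:Z -> cell x = n /\ cell_index x = i.
Proof.
move=> xE; rewrite /cell /cell_index xE divzMDl // modzMDl divz_nat modz_nat.
by rewrite divn_small // modn_small // addr0; split=> //; apply: val_inj; rewrite /= inordK.
Qed.

Lemma cell_decomposition x : x = cell x * q%:Z + site (cell_index x).
Proof.
have q0 : q%:Z != 0 by [].
have m0 := modz_ge0 (x + (p./2)%:Z) q0.
have mq : ((x + (p./2)%:Z) %% q%:Z)%Z < q%:Z by rewrite ltz_pmod.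
have := divz_eq (x + (p./2)%:Z) q; rewrite /site /= /cell /cell_index inordK; last by lia.
by rewrite gez0_abs //; lia.
Qed.

Lemma periodic_cell n x : V (n * q%:Z + x) = V x.
Proof.
have Vk (k : nat) y : V (y + k%:Z * q%:Z) = V y.
  elim: k y => [|k IH] y; first by rewrite mul0r addr0.
  by rewrite -addn1 PoszD mulrDl mul1r addrA Vq IH.
case: n => k; first by rewrite addrC Vk.
rewrite NegzE -(Vk k.+1); congr V; ring.
Qed.

(* The multiplier over one period is e^(-iqk), the sign being imposed by the corner
   entry e^(iqk) of the Floquet matrix. *)
Definition bloch (k : R) (v : 'cV[C]_q) (x : int) : C :=
  cis (- (q%:R * k * (cell x)%:~R)) * v (cell_index x) 0.

Let entry (v : 'cV[C]_q) (a : nat) : C := if insub a is Some i then v i 0 else 0.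

Let sum_entry (v : 'cV[C]_q) a : \sum_(j < q) ((j == a :> nat)%:R) * v j 0 = entry v a.
Proof.
rewrite /entry; case: insubP => [i iq ia|aq].
  rewrite (bigD1 i) //= ia eqxx mul1r big1 ?addr0 // => j ji.
  by rewrite -ia (inj_eq val_inj) (negbTE ji) mul0r.
rewrite big1 // => j _; rewrite (_ : (j == a :> nat) = false) ?mul0r //.
by apply/negbTE; rewrite neq_ltn (leq_trans (ltn_ord j)) // leqNgt.
Qed.

Let entryE (v : 'cV[C]_q) (i : 'I_q) : entry v i = v i 0.
Proof. by rewrite /entry valK. Qed.

Let floquet_row k (v : 'cV[C]_q) (i : 'I_q) :
  (floquet V q k *m v) i 0 = (V (site i))%:C%C * v i 0 + entry v i.+1
    + (if (i : nat) is i'.+1 then entry v i' else 0 : C)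
    + (i == 0%N :> nat)%:R * cis (q%:R * k) * entry v p
    + (i == p :> nat)%:R * cis (- (q%:R * k)) * entry v 0.
Proof.
rewrite mxE -!sum_entry.
have -> : (V (site i))%:C%C * v i 0 = \sum_(j < q) (V (site i))%:C%C * ((j == i :> nat)%:R * v j 0).
  by rewrite -mulr_sumr sum_entry entryE.
have -> : (if (i : nat) is i'.+1 then entry v i' else 0 : C) = \sum_(j < q) (i == j.+1 :> nat)%:R * v j 0.
  case: (nat_of_ord i) => [|i']; last by rewrite -sum_entry; apply: eq_bigr => j _; rewrite eqSS eq_sym.
  by rewrite big1 // => j _; rewrite mul0r.
rewrite !mulr_sumr -!big_split /=; apply: eq_bigr => j _; rewrite !mxE.
have -> : (((j == i.+1 :> nat) || (i == j.+1 :> nat))%:R : C) = (j == i.+1 :> nat)%:R + (i == j.+1 :> nat)%:R.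
  by case: eqP => [->|_] /=; rewrite ?add0r // (_ : (nat_of_ord i == i.+2) = false) ?addr0 //; lia.
rewrite -[i == j](inj_eq val_inj) /= [nat_of_ord j == i]eq_sym /cis cosN sinN.
move: (_ == i.+1) (_ == j.+1) => b1 b2.
by case: (_ == j :> nat); do 2![case: (_ == 0%N)]; do 2![case: (_ == p)];
  rewrite /= ?mulr1n ?mulr0n; ring.
Qed.

Lemma schrodinger_bloch k v :
  schrodinger V (bloch k v) = bloch k (floquet V q k *m v).
Proof.
apply/funext => x; have xE := cell_decomposition x.
set n := cell x in xE; set i := cell_index x in xE.
have xE' : x + (p./2)%:Z = n * q%:Z + i%:Z by rewrite {1}xE /site /=; ring.
have Vx : V x = V (site i) by rewrite {1}xE periodic_cell.
rewrite /schrodinger Vx [RHS]/bloch -/n -/i floquet_row.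
set K := q%:R * k.
have prev : bloch k v (x - 1) = cis (- (K * n%:~R)) *
    ((if (i : nat) is i'.+1 then entry v i' else 0 : C) + (i == 0%N :> nat)%:R * cis K * entry v p).
  rewrite /bloch; case iE : (nat_of_ord i) => [|i'].
    have [|-> ->] := @cell_indexE (x - 1) (n - 1) ord_max; first by rewrite /= mulrBl; lia.
    rewrite -entryE eqxx add0r mul1r mulrA -cisD; congr (cis _ * _).
    by rewrite intrB mulr1z -/K; ring.
  have i'q : (i' < q)%N by have := ltn_ord i; lia.
  have [|-> ->] := @cell_indexE (x - 1) n (Ordinal i'q); first by rewrite /=; lia.
  by rewrite mul0r mul0r addr0 -(entryE _ (Ordinal i'q)).
have next : bloch k v (x + 1) = cis (- (K * n%:~R)) *
    (entry v i.+1 + (i == p :> nat)%:R * cis (- K) * entry v 0).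
  rewrite /bloch; have [ip|ip] := eqVneq (i : nat) p.
    have [|-> ->] := @cell_indexE (x + 1) (n + 1) ord0; first by rewrite /= mulrDl; lia.
    rewrite -entryE ip {2}/entry insubN ?ltnn // add0r mul1r mulrA -cisD; congr (cis _ * _).
    by rewrite intrD mulr1z -/K; ring.
  have iq : (i.+1 < q)%N by have := ltn_ord i; lia.
  have [|-> ->] := @cell_indexE (x + 1) n (Ordinal iq); first by rewrite /=; lia.
  by rewrite mul0r mul0r addr0 -(entryE _ (Ordinal iq)).
rewrite prev next {1}/bloch -/n -/i -/K.
move: ((V _)%:C%C) (v i 0) => W vi.
move: (entry v p) (entry v 0) (entry v i.+1) (cis K) (cis (- K)) (cis (- (K * _))) => e1 e2 e3 e4 e5 e6.
by case: (nat_of_ord i) => [|i'] /=; [|move: (entry v i') => e7];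
  move: (_%:R) (_%:R) => f1 f2; ring.
Qed.

Lemma iter_schrodinger_bloch j k v :
  iter j (schrodinger V) (bloch k v) = bloch k (iter j (mulmx (floquet V q k)) v).
Proof. by elim: j => //= j ->; rewrite schrodinger_bloch. Qed.

Definition periodized_delta N (m : int) (x : int) : C := (((q * N)%N %| x - m)%Z)%:R.

Lemma periodized_delta_bloch N m x : (0 < N)%N ->
  periodized_delta N m x = \sum_(r < N)
    (N%:R^-1 * cis (angle R N r * (cell m)%:~R)) *
    bloch (angle R N r / q%:R) (delta_mx (cell_index m) 0) x.
Proof.
move=> N0; have NR : (N%:R : C) != 0 by rewrite pnatr_eq0 -lt0n.
have -> : \sum_(r < N) (N%:R^-1 * cis (angle R N r * (cell m)%:~R)) *
    bloch (angle R N r / q%:R) (delta_mx (cell_index m) 0) x =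
  N%:R^-1 * (\sum_(r < N) cis (angle R N r * (cell m - cell x)%:~R)) * (cell_index x == cell_index m)%:R.
  rewrite mulr_sumr mulr_suml; apply: eq_bigr => r _.
  rewrite /bloch mxE eqxx andbT [q%:R * _]mulrC divfK ?pnatr_eq0 // !mulrA; congr (_ * _).
  by rewrite -!mulrA -cisD; congr (_ * cis _); rewrite intrB; ring.
rewrite sum_roots_of_unity // /periodized_delta.
have xm : x - m = (cell x - cell m) * q%:Z + ((cell_index x)%:Z - (cell_index m)%:Z).
  by rewrite {1}(cell_decomposition x) {1}(cell_decomposition m) /site; ring.
have [ixm|ixm] := eqVneq (cell_index x) (cell_index m).
  rewrite xm ixm subrr addr0 mulr1 mulnC PoszM dvdz_mul2r // !dvdzE (distnC (cell m)).
  by case: ifP => _; rewrite ?mulr0 ?mulVf.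
rewrite mulr0; case: dvdzP => // -[a aE]; exfalso; move/eqP: ixm; apply; apply: val_inj.
have [|_ xi] := @cell_indexE x (cell m + a * N%:Z) (cell_index m); last by rewrite xi.
have := cell_decomposition m; rewrite /site /= PoszM in aE * => h.
have -> : x = m + a * (q%:Z * N%:Z) by rewrite -aE; ring.
by rewrite {1}h; ring.
Qed.

End Bloch.

(** * Approximation of the amplitude by a finite ring *)

Section ExponentialSeries.
Variable R : realType.
Local Notation C := R[i].
Local Notation nc := (@Normc.normc R).

Lemma imaginary_powerE (x : R) k :
  (0 -i* x)%C ^+ k / k`!%:R = (cos_coeff x k -i* sin_coeff x k)%C :> C.
Proof.
have pow j : (0 -i* x)%C ^+ j.*2 = ((-1) ^+ j * x ^+ j.*2)%:C%C :> C.
  rewrite -mul2n [in RHS]exprM exprM -exprMn rmorphXn; congr (_ ^+ _).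
  by apply/eqP; rewrite !expr2 eq_complex /=; apply/andP; split; apply/eqP; ring.
have zE : (0 -i* x)%C ^+ k = (((~~ odd k)%:R * (-1) ^ k./2 * x ^+ k)
    -i* ((odd k)%:R * (-1) ^+ k.-1./2 * x ^+ k))%C :> C.
  have := odd_double_half k; case ok : (odd k) => kE /=.
    have -> : k.-1./2 = k./2 by rewrite -{1}kE /= doubleK.
    have -> : x ^+ k = x * x ^+ k./2.*2 by rewrite -{1}kE exprS.
    rewrite -{1}kE add1n exprS pow.
    by apply/eqP; rewrite eq_complex /=; apply/andP; split; apply/eqP; ring.
  by rewrite add0n in kE; rewrite -{1}kE pow kE mul0r mul0r mul1r oppr0.
rewrite zE -(rmorph_nat (real_complex R)) -fmorphV.
by apply/eqP; rewrite eq_complex /= !mulr0 subr0 add0r mulNr !eqxx.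
Qed.

Lemma cis_series (x e : R) : 0 < e ->
  \forall K \near \oo, nc (\sum_(k < K) (0 -i* x)%C ^+ k / k`!%:R - cis (- x)) <= e.
Proof.
move=> e0; have h0 : 0 < e / 2 by rewrite divr_gt0.
have /cvgrPdist_le /(_ _ h0) hc : series (cos_coeff x) @ \oo --> cos x.
  by rewrite unlock; exact: is_cvg_series_cos_coeff.
have /cvgrPdist_le /(_ _ h0) hs : series (sin_coeff x) @ \oo --> sin x.
  by rewrite unlock; exact: is_cvg_series_sin_coeff.
near=> K.
have -> : \sum_(k < K) (0 -i* x)%C ^+ k / k`!%:R
   = (series (cos_coeff x) K -i* series (sin_coeff x) K)%C :> C.
  rewrite /series /= !big_mkord; elim/big_ind3 : _ => //.
  - by apply/eqP; rewrite eq_complex /= oppr0 !eqxx.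
  - move=> a1 a2 a3 b1 b2 b3 -> ->; apply/eqP; rewrite eq_complex /= eqxx.
    by apply/eqP; ring.
  - by move=> k _; exact: imaginary_powerE.
apply: le_trans (nc_le_ReIm _) _; rewrite /cis cosN sinN /=.
rewrite [leRHS](splitr e) lerD //.
  by rewrite distrC; near: K.
by rewrite opprK addrC; near: K.
Unshelve. all: by end_near. Qed.

End ExponentialSeries.

Section AmplitudeApproximation.
Variables (R : realType) (p : nat) (V : int -> R) (M : R).
Local Notation C := R[i].
Local Notation nc := (@Normc.normc R).
Local Notation q := p.+1.
Variables (lam : R -> 'I_q -> R) (Psi : R -> 'I_q -> 'cV[C]_q).
Hypothesis es : forall k, eigensystem (floquet V q k) (lam k) (Psi k).
Hypothesis Vq : periodic V q.
Hypothesis VM : forall n, `|V n| <= M.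
Variables (m : int) (n : nat).

Lemma amplitude_series t (l x : int) (e : R) : 0 < e ->
  \forall K \near \oo,
    nc (\sum_(k < K) (0 -i* t)%C ^+ k / k`!%:R * iter k (schrodinger V) (delta R l) x
        - amplitude V t x l) <= e.
Proof.
move=> e0; have /cvgrPdist_le := @is_cvg_exp_schrodinger R V q (0 -i* t)%C l x isT Vq.
have e0' : 0 < e%:C%C by rewrite ltcR.
move=> /(_ _ e0'); apply: filterS => K; rewrite -lecR -ncE distrC.
by rewrite /series /= big_mkord.
Qed.

Definition momentum N (r : nat) : R := angle R N r / q%:R.

Definition ring_weight N (r : nat) (j : 'I_q) : R :=
  nc (Psi (momentum N r) j (cell_index p m) 0) ^+ 2.

Definition ring_coef N (r : nat) (j : 'I_q) : C :=
  N%:R^-1 * cis (- (angle R N r * n%:R)) * (ring_weight N r j)%:C%C.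

(* The amplitude on a ring of N periods, in the eigenbasis of Bloch waves. *)
Definition ring_amplitude N (t : R) : C :=
  \sum_(r < N) \sum_j ring_coef N r j * cis (- (t * lam (momentum N r) j)).

Let site_nm : int := n%:Z * q%:Z + m.

Lemma ring_moments N k : (0 < N)%N ->
  iter k (schrodinger V) (@periodized_delta R p N m) site_nm =
  \sum_(r < N) \sum_j ring_coef N r j * (lam (momentum N r) j)%:C%C ^+ k.
Proof.
move=> N0.
have -> : @periodized_delta R p N m = fun x => \sum_(r < N)
    (N%:R^-1 * cis (angle R N r * (cell p m)%:~R)) *
    bloch (angle R N r / q%:R) (delta_mx (cell_index p m) 0) x.
  by apply/funext => x; exact: periodized_delta_bloch.
rewrite iter_schrodinger_sum; apply: eq_bigr => r _.
rewrite iter_schrodinger_bloch // /bloch.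
have [|-> ->] := @cell_indexE p site_nm (n%:Z + cell p m) (cell_index p m).
  by have := cell_decomposition p m; rewrite /site_nm /site /= => {1}->; ring.
rewrite (iter_mulmx_eigen (es _)) mulr_sumr mulr_sumr; apply: eq_bigr => j _.
rewrite /ring_coef /ring_weight -/(momentum N r) !mulrA; congr (_ * _ * _).
rewrite -!mulrA -cisD; congr (_ * cis _).
rewrite /momentum intrD -pmulrn; field.
by rewrite nat1r !pnatr_eq0 -lt0n N0.
Qed.

Lemma ring_weight_sum N r : \sum_j ring_weight N r j = 1.
Proof. exact: (eigensystem_weights (es _)). Qed.

Lemma nc_ring_coef N r j : nc (ring_coef N r j) = N%:R^-1 * ring_weight N r j.
Proof.
rewrite /ring_coef !Normc.normcM Normc.normcV nc_nat nc_cis mulr1 nc_real ger0_norm //.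
exact: sqr_ge0.
Qed.

Lemma ring_coef_sum N : (0 < N)%N -> \sum_(r < N) \sum_j nc (ring_coef N r j) = 1.
Proof.
move=> N0; under eq_bigr => r _.
  under eq_bigr do rewrite nc_ring_coef.
  by rewrite -mulr_sumr ring_weight_sum mulr1; over.
by rewrite sumr_const card_ord -[_ *+ _]mulr_natr mulVf // pnatr_eq0 -lt0n.
Qed.

Lemma ring_amplitude_le1 N t : (0 < N)%N -> nc (ring_amplitude N t) <= 1.
Proof.
move=> N0; rewrite -(ring_coef_sum N0).
apply: le_trans (nc_sum _ _ _) _; apply: ler_sum => r _.
apply: le_trans (nc_sum _ _ _) _; apply: ler_sum => j _.
by rewrite Normc.normcM nc_cis mulr1.
Qed.

Lemma delta_local N k : (k + n < N)%N ->
  iter k (schrodinger V) (delta R m) site_nm =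
  iter k (schrodinger V) (@periodized_delta R p N m) site_nm.
Proof.
move=> knN; apply: iter_schrodinger_local => y; rewrite /site_nm => yx.
rewrite /delta /periodized_delta; congr (_%:R); congr nat_of_bool.
apply/eqP/idP => [->|]; first by rewrite subrr dvdz0.
move=> /dvdzP[a aE]; have {aE} yE : y = m + a * (q%:Z * N%:Z) by rewrite PoszM in aE; lia.
have [a0|a0] := eqVneq a 0; first by rewrite yE a0 mul0r addr0.
exfalso; rewrite yE in yx.
have : `|a * N%:Z - n%:Z| * q%:Z <= k%:Z.
  rewrite -[X in _ * X](ger0_norm (_ : 0 <= q%:Z)) // -normrM.
  by apply: le_trans yx; rewrite le_eqVlt; apply/orP; left; apply/eqP; congr `|_|; ring.
have h : (N%:Z - n%:Z) <= `|a * N%:Z - n%:Z|.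
  have : N%:Z <= `|a * N%:Z| by rewrite normrM (ger0_norm (_ : 0 <= N%:Z)) // ler_peMl //; lia.
  have := lerB_normD (a * N%:Z) (- n%:Z); rewrite normrN; lia.
have : `|a * N%:Z - n%:Z| <= `|a * N%:Z - n%:Z| * q%:Z by rewrite ler_peMr.
lia.
Qed.

Lemma ring_amplitude_close N t b : (n < N)%N -> `|t| * (2 + M) <= b ->
  nc (amplitude V t site_nm m - ring_amplitude N t)
    <= 2 * (expR b - series (exp_coeff b) (N - n)%N).
Proof.
move=> nN tb; have N0 : (0 < N)%N by lia.
have M0 : 0 <= M by apply: le_trans (VM 0).
have b0 : 0 <= b by apply: le_trans tb; rewrite mulr_ge0 // addr_ge0.
apply/ler_addgt0Pr => e e0.
have e20 : 0 < e / 2 by rewrite divr_gt0.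
near \oo => K.
have h1 : nc (\sum_(k < K) (0 -i* t)%C ^+ k / k`!%:R * iter k (schrodinger V) (delta R m) site_nm
        - amplitude V t site_nm m) <= e / 2.
  by near: K; exact: amplitude_series.
have h2 (r : 'I_N) (j : 'I_q) : nc (\sum_(k < K) (0 -i* (t * lam (momentum N r) j))%C ^+ k / k`!%:R
    - cis (- (t * lam (momentum N r) j))) <= e / 2.
  move: r j; near: K; apply: filter_forall => r; apply: filter_forall => j.
  exact: cis_series.
have NK : (N - n <= K)%N by near: K; exact: nbhs_infty_ge.
pose S := \sum_(k < K) (0 -i* t)%C ^+ k / k`!%:R * iter k (schrodinger V) (delta R m) site_nm.
pose S' := \sum_(k < K) (0 -i* t)%C ^+ k / k`!%:R
  * iter k (schrodinger V) (@periodized_delta R p N m) site_nm.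
have h3 : nc (S' - ring_amplitude N t) <= e / 2.
  have -> : S' = \sum_(r < N) \sum_j ring_coef N r j *
      \sum_(k < K) (0 -i* (t * lam (momentum N r) j))%C ^+ k / k`!%:R.
    rewrite /S'; under eq_bigr do rewrite ring_moments // mulr_sumr.
    rewrite exchange_big; apply: eq_bigr => r _ /=.
    under eq_bigr do rewrite mulr_sumr.
    rewrite exchange_big; apply: eq_bigr => j _ /=.
    rewrite mulr_sumr; apply: eq_bigr => k _.
    have -> : (0 -i* (t * lam (momentum N r) j))%C = (0 -i* t)%C * (lam (momentum N r) j)%:C%C :> C.
      by apply/eqP; rewrite eq_complex /=; apply/andP; split; apply/eqP; ring.
    by rewrite exprMn; ring.
  have -> : e / 2 = (\sum_(r < N) \sum_j nc (ring_coef N r j)) * (e / 2).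
    by rewrite ring_coef_sum // mul1r.
  rewrite /ring_amplitude -sumrB mulr_suml.
  apply: le_trans (nc_sum _ _ _) _; apply: ler_sum => r _.
  rewrite -sumrB mulr_suml; apply: le_trans (nc_sum _ _ _) _; apply: ler_sum => j _.
  by rewrite -mulrBr Normc.normcM ler_wpM2l ?nc_ge0 //; exact: h2.
have h4 : nc (S - S') <= 2 * (expR b - series (exp_coeff b) (N - n)%N).
  apply: (@le_trans _ _ (2 * (series (exp_coeff b) K - series (exp_coeff b) (N - n)%N))); last first.
    rewrite ler_pM2l // lerB //; apply: nondecreasing_cvgn_le.
      apply/nondecreasing_seqP => k; rewrite /series /= big_nat_recr //= lerDl.
      exact: exp_coeff_ge0.
    exact: is_cvg_series_exp_coeff.
  rewrite sub_series_geq // -sumrB -(big_mkord xpredT (fun k =>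
    (0 -i* t)%C ^+ k / k`!%:R * iter k (schrodinger V) (delta R m) site_nm -
    (0 -i* t)%C ^+ k / k`!%:R * iter k (schrodinger V) (@periodized_delta R p N m) site_nm)).
  rewrite (big_cat_nat (leq0n (N - n)) NK) /= big_nat big1 ?add0r => [|k /andP[_ kN]]; last first.
    by rewrite (@delta_local N) ?subrr //; lia.
  rewrite mulr_sumr; apply: le_trans (nc_sum _ _ _) _; apply: ler_sum => k _.
  rewrite -mulrBr !Normc.normcM Normc.normcV nc_nat ncX.
  have -> : nc (0 -i* t)%C = `|t| by rewrite /= expr0n add0r sqrrN sqrtr_sqr.
  have d1 : nc (iter k (schrodinger V) (delta R m) site_nm) <= (2 + M) ^+ k.
    apply: iter_schrodinger_bound => // y; rewrite /delta nc_nat.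
    by case: eqP.
  have d2 : nc (iter k (schrodinger V) (@periodized_delta R p N m) site_nm) <= (2 + M) ^+ k.
    apply: iter_schrodinger_bound => // y; rewrite /periodized_delta nc_nat.
    by case: (_ %| _)%Z.
  have d3 := nc_leD (iter k (schrodinger V) (delta R m) site_nm)
    (- iter k (schrodinger V) (@periodized_delta R p N m) site_nm).
  rewrite ncN in d3.
  apply: (@le_trans _ _ (`|t| ^+ k / k`!%:R * (2 * (2 + M) ^+ k))).
    by rewrite ler_wpM2l ?divr_ge0 ?exprn_ge0 //; lra.
  have -> : `|t| ^+ k / k`!%:R * (2 * (2 + M) ^+ k) = 2 * ((`|t| * (2 + M)) ^+ k / k`!%:R).
    by rewrite exprMn; ring.
  rewrite ler_pM2l // /exp_coeff /= ler_wpM2r ?invr_ge0 // lerXn2r ?nnegrE //.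
  by rewrite mulr_ge0 // addr_ge0.
have -> : amplitude V t site_nm m - ring_amplitude N t
   = (S - S') + ((S' - ring_amplitude N t) + - (S - amplitude V t site_nm m)) by ring.
apply: le_trans (nc_leD _ _) _; rewrite lerD // [leRHS](splitr e).
by apply: le_trans (nc_leD _ _) _; rewrite ncN lerD.
Unshelve. all: by end_near. Qed.

Lemma ring_amplitude_cvg (L e : R) : 0 < e ->
  \forall N \near \oo, forall t, `|t| <= L ->
    nc (amplitude V t site_nm m - ring_amplitude N t) <= e.
Proof.
move=> e0; set b := L * (2 + M).
have M0 : 0 <= M by apply: le_trans (VM 0).
have e20 : 0 < e / 2 by rewrite divr_gt0.
have /cvgrPdist_le /(_ _ e20) [K _ hK] : series (exp_coeff b) @ \oo --> expR b.
  exact: is_cvg_series_exp_coeff.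
near=> N => t tL.
have nN : (n < N)%N by near: N; exact: nbhs_infty_gt.
apply: le_trans (ring_amplitude_close (b := b) nN _) _.
  by rewrite ler_wpM2r // addr_ge0.
have /hK : (K <= N - n)%N.
  have Kn : (K + n <= N)%N by near: N; exact: nbhs_infty_ge.
  by rewrite /=; lia.
move=> h; have := le_trans (ler_norm _) h => /=; lra.
Unshelve. all: by end_near. Qed.

Lemma amplitude_le1 t : nc (amplitude V t site_nm m) <= 1.
Proof.
apply/ler_addgt0Pr => e e0.
near \oo => N.
have N0 : (0 < N)%N by near: N; exact: nbhs_infty_gt.
have /(_ t (lexx _)) h : forall s, `|s| <= `|t| ->
    nc (amplitude V s site_nm m - ring_amplitude N s) <= e.
  by near: N; exact: ring_amplitude_cvg.
have := nc_leD (amplitude V t site_nm m - ring_amplitude N t) (ring_amplitude N t).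
have := ring_amplitude_le1 t N0; rewrite subrK; lra.
Unshelve. all: by end_near. Qed.

End AmplitudeApproximation.

(** * Exponential sums *)

Lemma is_derive_mull (R : realType) (a t : R) : is_derive t 1 ( *%R a) a.
Proof.
have -> : *%R a = a *: (id : R -> R) by apply/funext.
by apply: is_derive_eq; rewrite /GRing.scale /= mulr1.
Qed.

Section ComplexExponentials.
Variable R : realType.
Local Notation C := R[i].
Local Notation nc := (@Normc.normc R).
Implicit Types (mu : C) (t : R).

(* e^(- mu t) *)
Definition cexpN mu t : C :=
  (expR (- complex.Re mu * t))%:C%C * cis (- (complex.Im mu * t)).

Definition cexpN_primitive mu t : C :=
  if mu == 0 then t%:C%C else (1 - cexpN mu t) / mu.

Lemma nc_cexpN mu t : nc (cexpN mu t) = expR (- complex.Re mu * t).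
Proof. by rewrite Normc.normcM nc_cis mulr1 nc_real ger0_norm ?expR_ge0. Qed.

Lemma cexpND mu nu t : cexpN (mu + nu) t = cexpN mu t * cexpN nu t.
Proof.
rewrite /cexpN mulrACA -cisD -rmorphM /= -expRD; congr ((expR _)%:C%C * cis _).
  by case: mu nu => [a b] [c d] /=; ring.
by case: mu nu => [a b] [c d] /=; ring.
Qed.

Lemma conj_cexpN mu t : (cexpN mu t)^* = cexpN mu^* t.
Proof.
case: mu => a b; rewrite conjM conj_cis (conjCE (a +i* b)%C) /cexpN /= mulNr.
by congr (_ * _); [exact: conjc_real|rewrite mulNr].
Qed.

Lemma cexpN0 mu : cexpN mu 0 = 1.
Proof. by rewrite /cexpN !mulr0 expR0 oppr0 cis0 mul1r. Qed.

Lemma Re_cexpN c mu t : complex.Re (c * cexpN mu t) =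
  expR (- complex.Re mu * t) *
    (complex.Re c * cos (complex.Im mu * t) + complex.Im c * sin (complex.Im mu * t)).
Proof.
by rewrite /cexpN /cis cosN sinN; case: c mu => [a b] [x y] /=; ring.
Qed.

Lemma is_derive_Re_cexpN c mu t :
  is_derive t 1 (fun s => complex.Re (c * cexpN mu s)) (complex.Re (- mu * c * cexpN mu t)).
Proof.
have -> : (fun s => complex.Re (c * cexpN mu s)) =
    (expR \o ( *%R (- complex.Re mu))) *
    (complex.Re c *: (cos \o ( *%R (complex.Im mu))) + complex.Im c *: (sin \o ( *%R (complex.Im mu)))).
  by apply/funext => s; rewrite Re_cexpN.
have dE := is_derive1_comp (is_derive_expR (- complex.Re mu * t)) (is_derive_mull (- complex.Re mu) t).
have dc := is_derive1_comp (is_derive_cos (complex.Im mu * t)) (is_derive_mull (complex.Im mu) t).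
have ds := is_derive1_comp (is_derive_sin (complex.Im mu * t)) (is_derive_mull (complex.Im mu) t).
have d := is_deriveM dE (is_deriveD (is_deriveZ (complex.Re c) dc) (is_deriveZ (complex.Im c) ds)).
apply: (is_derive_eq d).
rewrite /cexpN /cis cosN sinN /=; case: c mu {dE dc ds d} => [a b] [x y] /=.
rewrite !fctE /= -[a *: _]/(a * _) -[b *: _]/(b * _) /GRing.scale /=. ring.
Qed.

Lemma is_derive_Re_primitive c mu t :
  is_derive t 1 (fun s => complex.Re (c * cexpN_primitive mu s)) (complex.Re (c * cexpN mu t)).
Proof.
rewrite /cexpN_primitive; have [->|mu0] := eqVneq mu 0.
  have -> : (fun s : R => complex.Re (c * s%:C%C)) = complex.Re c *: (id : R -> R).
    by apply/funext => s; case: c => a b /=; rewrite mulr0 subr0.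
  apply: is_derive_eq; rewrite /cexpN /= oppr0 !mul0r expR0 oppr0 cis0 !mulr1.
  by rewrite scaler1.
have -> : (fun s : R => complex.Re (c * ((1 - cexpN mu s) / mu))) =
    cst (complex.Re (c / mu)) + (fun s => complex.Re ((- (c / mu)) * cexpN mu s)).
  by apply/funext => s; rewrite fctE /= -ReD; congr complex.Re; ring.
have h := is_derive_Re_cexpN (- (c / mu)) mu t.
apply: (is_derive_eq (is_deriveD (is_derive_cst _ _ _) h)).
by rewrite add0r; congr complex.Re; field.
Qed.

Variables (n : nat) (c : 'I_n -> C) (mu : 'I_n -> C).

Let expsum t := complex.Re (\sum_i c i * cexpN (mu i) t).

Lemma continuous_expsum : continuous expsum.
Proof.
move=> t; apply: differentiable_continuous; apply/derivable1_diffP.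
have -> : expsum = \sum_i (fun s => complex.Re (c i * cexpN (mu i) s)).
  by apply/funext => s; rewrite /expsum Re_sum fct_sumE.
apply: ex_derive; apply: is_derive_sum => i; exact: is_derive_Re_cexpN.
Qed.

Lemma integral_expsum L (k : R) : 0 < L ->
  (\int[lebesgue_measure]_(t in `[0%R, L]) (expsum t + k)%:E
    = (complex.Re (\sum_i c i * cexpN_primitive (mu i) L) + k * L)%:E)%E.
Proof.
move=> L0; pose F t := complex.Re (\sum_i c i * cexpN_primitive (mu i) t) + k * t.
have dF t : is_derive t 1 F (expsum t + k).
  have -> : F = \sum_i (fun s => complex.Re (c i * cexpN_primitive (mu i) s)) + k *: (id : R -> R).
    by apply/funext => s; rewrite /F Re_sum fctE fct_sumE.
  have h : is_derive t 1 (\sum_i (fun s => complex.Re (c i * cexpN_primitive (mu i) s)))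
      (\sum_i complex.Re (c i * cexpN (mu i) t)).
    by apply: is_derive_sum => i; exact: is_derive_Re_primitive.
  have d := is_deriveD h (is_deriveZ k (is_derive_id t (1 : R))).
  by apply: (is_derive_eq d); rewrite scaler1 /expsum Re_sum.
have cF t : {for t, continuous F}.
  apply: differentiable_continuous; apply/derivable1_diffP.
  by apply: ex_derive; exact: dF.
have ce : continuous (fun t => expsum t + k).
  by move=> t; apply: continuousD; [exact: continuous_expsum|exact: cst_continuous].
rewrite (@continuous_FTC2 _ _ F) //.
- have F0 : \sum_i c i * cexpN_primitive (mu i) 0 = 0.
    apply: big1 => i _; rewrite /cexpN_primitive cexpN0 subrr mul0r.
    by case: ifP => _; rewrite mulr0.
  by rewrite -EFinB /F F0 mulr0 addr0 subr0.
- exact: continuous_subspaceT.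
- split; first by move=> t _; apply: ex_derive; exact: dF.
  + by apply: cvg_at_right_filter; exact: cF.
  + by apply: cvg_at_left_filter; exact: cF.
- by move=> t _; rewrite derive1E (@derive_val _ _ _ _ _ _ _ (dF t)).
Qed.

End ComplexExponentials.

Lemma sum_pairE (W : nmodType) (A B : finType) (f : A * B -> W) :
  \sum_x f x = \sum_a \sum_b f (a, b).
Proof. by rewrite pair_bigA; apply: eq_bigr => -[]. Qed.

Section Bessel.
Variable R : realType.
Local Notation C := R[i].
Local Notation nc := (@Normc.normc R).

Lemma sum_enum_val (I : finType) (F : I -> C) :
  \sum_i F i = \sum_(k < #|I|) F (enum_val k).
Proof. by rewrite -(big_enum_val F); apply: eq_bigl. Qed.

Lemma continuous_finite_expsum (I : finType) (c mu : I -> C) :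
  continuous (fun t => complex.Re (\sum_i c i * cexpN (mu i) t)).
Proof.
have -> : (fun t => complex.Re (\sum_i c i * cexpN (mu i) t)) =
    (fun t => complex.Re (\sum_(k < #|I|) c (enum_val k) * cexpN (mu (enum_val k)) t)).
  by apply/funext => t; rewrite sum_enum_val.
exact: continuous_expsum.
Qed.

Lemma integral_finite_expsum (I : finType) (c mu : I -> C) L (k : R) : 0 < L ->
  (\int[lebesgue_measure]_(t in `[0%R, L])
      (complex.Re (\sum_i c i * cexpN (mu i) t) + k)%:E
    = (complex.Re (\sum_i c i * cexpN_primitive (mu i) L) + k * L)%:E)%E.
Proof.
move=> L0; have := integral_expsum (fun k : 'I_#|I| => c (enum_val k))
  (fun k => mu (enum_val k)) k L0.
rewrite -(sum_enum_val (fun i => c i * cexpN_primitive (mu i) L)) => <-.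
apply: eq_integral => t _.
by rewrite sum_enum_val.
Qed.

Lemma expR_decay_integrable (A a : R) : 0 <= A -> 0 < a ->
  lebesgue_measure.-integrable `[0%R, +oo[ (EFin \o (fun t : R => A * expR (- a * t))).
Proof.
move=> A0 a0.
have cE : continuous (fun t : R => A * expR (- a * t)).
  move=> t; apply: (@continuousM _ R^o (fun=> A) (fun t => expR (- a * t))); first exact: cst_continuous.
  apply: continuous_comp; last exact: continuous_expR.
  exact: mulrl_continuous.
apply/integrableP; split.
  by apply/measurable_EFinP; apply: measurable_funTS; exact: continuous_measurable_fun.
under eq_integral do rewrite /= ger0_norm ?mulr_ge0 ?expR_ge0 //.
pose F (t : R) : R := - (A / a) * expR (- a * t).
have dF (t : R) : is_derive t 1 F (A * expR (- a * t)).
  have -> : F = - (A / a) *: (expR \o *%R (- a)) by apply/funext.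
  have dE := is_derive1_comp (is_derive_expR (- a * t)) (is_derive_mull (- a) t).
  apply: (is_derive_eq (is_deriveZ (- (A / a)) dE)); rewrite /GRing.scale /=; field; rewrite gt_eqF //.
rewrite (@ge0_continuous_FTC2y _ _ F 0 0) ?ltry //.
- by move=> x _; rewrite mulr_ge0 ?expR_ge0.
- exact: continuous_subspaceT.
- rewrite -(mulr0 (- (A / a))); apply: cvgM; first exact: cvg_cst.
  under eq_fun do rewrite mulNr.
  by apply: (cvg_comp _ _ (gt0_cvgMry a0 cvg_id) (@cvgr_expR R)).
- apply: cvg_at_right_filter; apply: differentiable_continuous; apply/derivable1_diffP.
  by apply: ex_derive; exact: dF.
- by move=> t _; rewrite derive1E (@derive_val _ _ _ _ _ _ _ (dF t)).
Qed.

Lemma expsum_le_integral (F : R -> R) (A a L k : R) (I : finType) (c mu : I -> C) :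
  0 <= A -> 0 < a -> 0 < L ->
  measurable_fun (`[0%R, +oo[%classic : set (g_sigma_algebraType R.-ocitv.-measurable)) F ->
  (forall t : R, 0 <= t -> 0 <= F t <= A * expR (- a * t)) ->
  (forall t : R, 0 <= t <= L -> complex.Re (\sum_i c i * cexpN (mu i) t) + k <= F t) ->
  complex.Re (\sum_i c i * cexpN_primitive (mu i) L) + k * L
    <= \int[lebesgue_measure]_(t in `[0, +oo[) F t.
Proof.
move=> A0 a0 L0 mF Fb kF.
have Fint : lebesgue_measure.-integrable `[0%R, +oo[ (EFin \o F).
  apply: (le_integrable _ _ _ (expR_decay_integrable A0 a0)) => //.
    exact/measurable_EFinP.
  move=> t; rewrite /= in_itv /= andbT => t0; have /andP[F0 F1] := Fb _ t0.
  by rewrite lee_fin !ger0_norm // mulr_ge0 ?expR_ge0.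
rewrite /Rintegral -lee_fin fineK; last exact: integrable_fin_num.
rewrite -integral_finite_expsum //.
have sub : (`[0%R, L]%classic : set R) `<=` `[0%R, +oo[%classic.
  by move=> t /=; rewrite !in_itv /= andbT => /andP[].
apply: (@le_trans _ _ (\int[lebesgue_measure]_(t in `[0%R, L]) (F t)%:E)%E).
  apply: le_integral => //.
  - apply: continuous_compact_integrable; first exact: segment_compact.
    apply: continuous_subspaceT => t.
    by apply: continuousD; [exact: continuous_finite_expsum|exact: cst_continuous].
  - have := @integrableS _ _ R lebesgue_measure `[0%R,+oo[%classic `[0%R,L]%classic (EFin \o F) _ _ sub Fint.
    by apply.
  - by move=> t; rewrite inE /= in_itv /= => tL; rewrite lee_fin kF.
apply: ge0_subset_integral => //.
  exact/measurable_EFinP.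
by move=> t /=; rewrite in_itv /= andbT lee_fin => t0; have /andP[] := Fb _ t0.
Qed.

Definition grid (E d : R) (N : nat) (r : nat) : R := E + r%:R * (d / N%:R).

(* The exponentials e^(-i E_r t) are orthogonal on [0, L] as L (E_r - E_r') lies
   in 2 pi Z; the bound is |h|^2 >= 2 Re (h conj g) - |g|^2 for the projection g of h. *)
Lemma bessel_expsum (I : finType) (c : I -> C) (om : I -> R) (eps E d : R) (N : nat) :
  (0 < N)%N -> 0 < d ->
  let L := 2 * pi * N%:R / d in
  exists J : finType, exists c' mu' : J -> C,
    (forall t, complex.Re (\sum_j c' j * cexpN (mu' j) t)
       <= nc (\sum_s c s * cexpN (eps +i* om s)%C t) ^+ 2) /\
    complex.Re (\sum_j c' j * cexpN_primitive (mu' j) L) =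
      L^-1 * \sum_(r < N)
        nc (\sum_s c s * cexpN_primitive (eps +i* (om s - grid E d N r))%C L) ^+ 2.
Proof.
move=> N0 d0 L; have p0 := pi_gt0 R.
have NR : 0 < N%:R :> R by rewrite ltr0n.
have L0 : 0 < L by rewrite divr_gt0 // !mulr_gt0.
pose hh (r : 'I_N) := \sum_s c s * cexpN_primitive (eps +i* (om s - grid E d N r))%C L.
pose b r := (L^-1)%:C%C * hh r.
pose c' (j : (I * 'I_N) + ('I_N * 'I_N)) : C := match j with
  | inl (s, r) => 2 * (c s * (b r)^*) | inr (r, r') => - (b r * (b r')^*) end.
pose mu' (j : (I * 'I_N) + ('I_N * 'I_N)) : C := match j with
  | inl (s, r) => (eps +i* (om s - grid E d N r))%C
  | inr (r, r') => (0 +i* (grid E d N r - grid E d N r'))%C end.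
have split_sum (F : C -> C) : \sum_j c' j * F (mu' j) =
    2 * (\sum_r (b r)^* * \sum_s c s * F (eps +i* (om s - grid E d N r))%C)
    - \sum_r \sum_r' b r * (b r')^* * F (0 +i* (grid E d N r - grid E d N r'))%C.
  rewrite big_sumType; congr (_ + _).
    rewrite sum_pairE exchange_big mulr_sumr; apply: eq_bigr => r _; rewrite !mulr_sumr; apply: eq_bigr => s _.
    by rewrite /c' /mu'; ring.
  rewrite sum_pairE -sumrN; apply: eq_bigr => r _; rewrite -sumrN; apply: eq_bigr => r' _.
  by rewrite mulNr.
exists ((I * 'I_N) + ('I_N * 'I_N))%type, c', mu'; split.
  move=> t; rewrite (split_sum (fun mu => cexpN mu t)).
  set h := \sum_s c s * cexpN (eps +i* om s)%C t.
  pose g := \sum_(r < N) b r * cexpN (0 +i* grid E d N r)%C t.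
  have gJ : g^* = \sum_(r < N) (b r)^* * cexpN (0 -i* grid E d N r)%C t.
    by rewrite conj_sum; apply: eq_bigr => r _; rewrite conjM conj_cexpN.
  have -> : \sum_r (b r)^* * (\sum_s c s * cexpN (eps +i* (om s - grid E d N r))%C t) = h * g^*.
    rewrite gJ mulr_sumr; apply: eq_bigr => r _; rewrite mulr_suml mulr_sumr.
    apply: eq_bigr => s _.
    have -> : (eps +i* (om s - grid E d N r))%C = (eps +i* om s)%C + (0 -i* grid E d N r)%C :> C.
      by apply/eqP; rewrite eq_complex /= addr0 !eqxx.
    by rewrite cexpND; ring.
  have -> : \sum_r \sum_r' b r * (b r')^* * cexpN (0 +i* (grid E d N r - grid E d N r'))%C t = g * g^*.
    rewrite gJ mulr_suml; apply: eq_bigr => r _; rewrite mulr_sumr; apply: eq_bigr => r' _.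
    have -> : (0 +i* (grid E d N r - grid E d N r'))%C = (0 +i* grid E d N r)%C + (0 -i* grid E d N r')%C :> C.
      by apply/eqP; rewrite eq_complex /= addr0 !eqxx.
    by rewrite cexpND; ring.
  have : 0 <= nc (h - g) ^+ 2 by exact: sqr_ge0.
  rewrite !nc_sqr conjCE; case: h => h1 h2; case: g {gJ} => g1 g2 /=; nra.
rewrite (split_sum (fun mu => cexpN_primitive mu L)).
have -> : \sum_r \sum_r' b r * (b r')^* * cexpN_primitive (0 +i* (grid E d N r - grid E d N r'))%C L
    = \sum_r (L * nc (b r) ^+ 2)%:C%C.
  apply: eq_bigr => r _; rewrite (bigD1 r) //= big1 ?addr0 => [|r' rr'].
    rewrite subrr /cexpN_primitive eqxx mul_conjE -rmorphM /= mulrC //.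
  have z0 : (0 +i* (grid E d N r - grid E d N r'))%C != 0 :> C.
    rewrite eq_complex /= eqxx /= /grid; apply/eqP => h.
    have : (r%:R - r'%:R) * (d / N%:R) = 0 :> R by rewrite -h; ring.
    move/eqP; rewrite mulf_eq0 [d / _ == 0]gt_eqF ?divr_gt0 // orbF subr_eq0 eqr_nat => /eqP e.
    by move: rr'; rewrite -(inj_eq val_inj) /= e eqxx.
  rewrite /cexpN_primitive (negbTE z0) /cexpN /= oppr0 mul0r expR0 mul1r.
  have -> : - ((grid E d N r - grid E d N r') * L) = 2 * pi * (r'%:Z - r%:Z)%:~R.
    rewrite /grid /L intrB -!pmulrn; field.
    by rewrite !gt_eqF.
  by rewrite cis_2pi subrr mul0r mulr0.
have -> : \sum_r (b r)^* * \sum_s c s * cexpN_primitive (eps +i* (om s - grid E d N r))%C L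
    = \sum_r (L * nc (b r) ^+ 2)%:C%C.
  apply: eq_bigr => r _; rewrite -/(hh r).
  have -> : hh r = L%:C%C * b r.
    by rewrite /b mulrA -rmorphM /= divff ?gt_eqF // mul1r.
  by rewrite mulrCA [_^* * _]mulrC mul_conjE -rmorphM.
have twice (x : R) : complex.Re (2 * x%:C%C - x%:C%C) = x.
  by rewrite (_ : 2 * _ - _ = x%:C%C) //; ring.
rewrite -rmorph_sum twice mulr_sumr; apply: eq_bigr => r _.
rewrite /b Normc.normcM nc_real ger0_norm ?invr_ge0 ?(ltW L0) //.
by field; rewrite gt_eqF.
Qed.

End Bessel.

(** * Lower bound for a single site *)

Lemma damped_square_le (R : realType) (f g del e : R) :
  0 <= f -> 0 <= g <= 1 -> 0 <= del -> 0 <= e <= 1 -> g <= del + f ->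
  g ^+ 2 * e - 2 * del <= f ^+ 2 * e.
Proof.
move=> f0 /andP[g0 g1] d0 /andP[e0 e1] gf.
have h : g ^+ 2 - 2 * del <= f ^+ 2.
  have [le_gf|lt_fg] := leP g f; first by have := lerXn2r 2 g0 f0 le_gf; lra.
  have : (g - f) * (g + f) <= del * 2 by apply: ler_pM; lra.
  by rewrite -subr_sqr; lra.
have : (g ^+ 2 - 2 * del) * e <= f ^+ 2 * e by rewrite ler_wpM2r.
have : 2 * del * e <= 2 * del by rewrite ler_piMr // mulr_ge0.
lra.
Qed.

Section SiteBound.
Variables (R : realType) (p : nat) (V : int -> R) (M : R).
Local Notation C := R[i].
Local Notation nc := (@Normc.normc R).
Local Notation q := p.+1.
Variables (lam : R -> 'I_q -> R) (Psi : R -> 'I_q -> 'cV[C]_q).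
Hypothesis es : forall k, eigensystem (floquet V q k) (lam k) (Psi k).
Hypothesis Vq : periodic V q.
Hypothesis VM : forall n, `|V n| <= M.

(* the momentum at which the discriminant vanishes *)
Definition mid_momentum : R := pi / 2 / q%:R.

Local Notation width := (band_width lam).

Let qR0 : q%:R != 0 :> R. Proof. by rewrite pnatr_eq0. Qed.

Lemma band_green_bounds (i : 'I_q) (j : 'I_q) (x eps : R) :
  0 <= x <= width j / (4 * q%:R ^+ 2) -> 0 < eps ->
  let z := ((lam mid_momentum j + x) +i* eps)%C in
  exists Dz a : C,
  [/\ forall k, \prod_l (z - (lam k l)%:C%C) = Dz - (2 * cos (q%:R * k))%:C%C,
      forall k, a = \prod_l (z - (lam k l)%:C%C) *
         \sum_l (nc (Psi k l i 0) ^+ 2)%:C%C / (z - (lam k l)%:C%C),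
      nc (Psi mid_momentum j i 0) ^+ 2 <= width j * nc a &
      nc (Dz - 2) + nc (Dz + 2) <=
        4 * (1 + 8 * q%:R ^+ 2 * eps ^+ 2 / width j ^+ 2) ^+ q].
Proof.
move=> xw eps0 z.
have [D DE] := floquet_discriminant es.
have [mu [muE inter]] := floquet_minor es i.
have resolvent k w : (forall l, w != (lam k l)%:C%C) ->
    \prod_l (w - (mu l)%:C%C) = \prod_l (w - (lam k l)%:C%C) *
       \sum_l (nc (Psi k l i 0) ^+ 2)%:C%C / (w - (lam k l)%:C%C).
  by move=> wk; rewrite -(cofactor_eigen (es k)) // muE.
have De w : \prod_l (w - (lam mid_momentum l)%:C%C) = D w.
  by rewrite DE /mid_momentum mulrCA divff // mulr1 cos_pihalf mulr0 subr0.
have Da w : \prod_l (w - (lam 0 l)%:C%C) = D w - 2.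
  by rewrite DE mulr0 cos0 mulr1 rmorph_nat.
have Db w : \prod_l (w - (lam (pi / q%:R) l)%:C%C) = D w + 2.
  by rewrite DE mulrCA divff // mulr1 cospi mulrN mulr1 rmorphN rmorph_nat opprK.
have ord := bands_ordered es.
have out k l : l != j -> outside (lam 0 j) (lam (pi / q%:R) j) (lam k l).
  rewrite neq_ltn /outside => /orP[lj|jl]; first by rewrite !(ord l j k _ lj).
  by rewrite !(ord j l _ k jl) orbT.
have same l : l != j -> 0 <= (lam mid_momentum j - lam 0 l) *
    (lam mid_momentum j - lam (pi / q%:R) l).
  rewrite neq_ltn => /orP[lj|jl].
    by rewrite mulr_ge0 ?subr_ge0 ?(ord l j _ _ lj).
  by rewrite mulr_le0 ?subr_le0 ?(ord j l _ _ jl).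
have mu_out l : outside (lam 0 j) (lam (pi / q%:R) j) (mu l).
  rewrite /outside; have [lj|jl] := ltnP l j.
    have h k : mu l <= lam k j.
      have /andP[_ h] := inter k l; apply: le_trans h _.
      by have [mono _ _] := es k; apply: mono; rewrite lift0.
    by rewrite !h.
  have h k : lam k j <= mu l.
    have /andP[h _] := inter k l; apply: le_trans h.
    by have [mono _ _] := es k; apply: mono.
  by rewrite !h orbT.
exists (D z), (\prod_l (z - (mu l)%:C%C)); split.
- by move=> k; exact: DE.
- by move=> k; apply: resolvent => l; rewrite eq_complex /= (gt_eqF eps0) andbF.
- apply: (@minor_lower_bound _ _ D _ _ _ mu j De Da Db same (out _) (out _) (out _) mu_out
    x eps xw eps0 (fun l => nc (Psi mid_momentum l i 0) ^+ 2)).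
  + by move=> l; exact: sqr_ge0.
  + by move=> w wn; exact: resolvent.
- exact: (@discriminant_bound _ _ D _ _ _ j De Da Db same (out _) (out _) x eps xw).
Qed.


Lemma measurable_abs2_amplitude (m : int) (n : nat) :
  measurable_fun (`[0%R, +oo[%classic : set (g_sigma_algebraType R.-ocitv.-measurable))
    (fun t => abs2 (amplitude V t (n%:Z * q%:Z + m) m)).
Proof.
pose f t := amplitude V t (n%:Z * q%:Z + m) m.
have part (a : C) : nc a = 1 ->
    measurable_fun (`[0%R, +oo[%classic : set (g_sigma_algebraType R.-ocitv.-measurable))
      (fun t => complex.Re (a * f t)).
  move=> a1; apply/measurable_EFinP.
  apply: (emeasurable_fun_cvg
    (fun N t => (complex.Re (a * ring_amplitude lam Psi m n N t))%:E)).
    move=> N; apply/measurable_EFinP; apply: measurable_funTS.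
    apply: continuous_measurable_fun.
    have -> : (fun t => complex.Re (a * ring_amplitude lam Psi m n N t)) =
        (fun t => complex.Re (\sum_(s : 'I_N * 'I_q)
          (a * ring_coef Psi m n N s.1 s.2) * cexpN (0 +i* lam (momentum R p N s.1) s.2)%C t)).
      apply/funext => t; congr complex.Re.
      rewrite sum_pairE /ring_amplitude mulr_sumr; apply: eq_bigr => r _.
      rewrite mulr_sumr; apply: eq_bigr => j _.
      by rewrite /cexpN /= oppr0 mul0r expR0 mul1r mulrA [t * _]mulrC.
    exact: continuous_finite_expsum.
  move=> t _; apply: cvg_EFin; first by near=> N.
  apply/cvgrPdist_le => e e0; near=> N.
  have /(_ t (lexx _)) h : forall s, `|s| <= `|t| ->
      nc (f s - ring_amplitude lam Psi m n N s) <= e.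
    by near: N; exact: (ring_amplitude_cvg es Vq VM).
  rewrite /= (_ : _ - _ = complex.Re (a * (f t - ring_amplitude lam Psi m n N t))).
    by apply: le_trans (Re_le_nc _) _; rewrite Normc.normcM a1 mul1r.
  by rewrite mulrBr; move: (a * f t) (a * ring_amplitude _ _ _ _ _ _) => [? ?] [? ?].
have -> : (fun t => abs2 (amplitude V t (n%:Z * q%:Z + m) m)) =
    (fun t => complex.Re (1 * f t) ^+ 2 + complex.Re (- 'i%C * f t) ^+ 2).
  apply/funext => t; rewrite /abs2 -/(f t) nc_sqr mul1r; congr (_ + _ ^+ 2).
  by case: (f t) => x y /=; ring.
apply: measurable_funD; apply: measurable_funX; apply: part; first exact: Normc.normc1.
by rewrite ncN /= expr0n expr1n add0r sqrtr1.
Unshelve. all: by end_near. Qed.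

Section Sampling.
Variables (m : int) (n : nat) (j : 'I_q) (T : R).
Hypothesis n0 : (0 < n)%N.
Hypothesis T0 : 0 < T.
Hypothesis width0 : 0 < width j.
Hypothesis slow : 512 * q%:R ^+ 3 * n%:R ^+ 2 <= width j ^+ 2 * T ^+ 2.

Local Notation phi := (nc (Psi mid_momentum j (cell_index p m) 0) ^+ 2).

Local Notation ring_transform N L E := (\sum_(s : 'I_N * 'I_q)
  ring_coef Psi m n N s.1 s.2 *
  cexpN_primitive (T^-1 +i* (lam (momentum R p N s.1) s.2 - E))%C L).

Lemma green_sample (x : R) : 0 <= x <= width j / (4 * q%:R ^+ 2) ->
  exists y : R, [/\ 0 < y < 1, 1 / 2 <= y ^+ n &
    forall N L, (n < N)%N -> y ^+ (N - n) <= 1 / 4 -> 0 < L ->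
    phi / (32 * width j) - expR (- T^-1 * L) * T <=
      nc (ring_transform N L (lam mid_momentum j + x))].
Proof.
move=> xw; have eps0 : 0 < T^-1 by rewrite invr_gt0.
have [Dz [a [DE aE phi_a disc]]] := band_green_bounds (cell_index p m) xw eps0.
set z := (_ +i* _)%C in DE aE.
have zn k l : z - (lam k l)%:C%C != 0.
  by rewrite eq_complex /= subr0 (gt_eqF eps0) andbF.
have [k|w [w0 w1 wE]] := @exists_decaying_multiplier R Dz.
  rewrite -subr_eq0; have := DE (k / q%:R); rewrite mulrCA divff // mulr1 => <-.
  by apply/prodf_neq0 => l _.
have y01 : 0 < nc w <= 1 by rewrite lt_neqAle nc_ge0 eq_sym nc_eq0 w0 ltW.
set u := (X in (1 + X) ^+ _) in disc.
have u0 : 0 <= u by rewrite divr_ge0 ?sqr_ge0 // mulr_ge0 ?sqr_ge0 // mulr_ge0 ?sqr_ge0.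
have [||half w4] := multiplier_power_bound (u := u) (q := q) y01 u0 n0.
- by have := disc; rewrite (multiplier_modulus w0 wE); lra.
- rewrite /u.
  have -> : 64 * q%:R * (8 * q%:R ^+ 2 * T^-1 ^+ 2 / width j ^+ 2) * n%:R ^+ 2
      = (512 * q%:R ^+ 3 * n%:R ^+ 2) / (width j ^+ 2 * T ^+ 2) :> R.
    by field; rewrite !gt_eqF.
  by rewrite ler_pdivrMr ?mul1r // mulr_gt0 ?exprn_gt0.
exists (nc w); rewrite half (andP y01).1 w1; split=> // N L nN small L0.
have N0 : (0 < N)%N by exact: leq_ltn_trans (leq0n n) nN.
set mus := fun s : 'I_N * 'I_q => (T^-1 +i* (lam (momentum R p N s.1) s.2 - (lam mid_momentum j + x)))%C : C.
have musE s : mus s = - 'i%C * (z - (lam (momentum R p N s.1) s.2)%:C%C).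
  by apply/eqP; rewrite eq_complex /=; apply/andP; split; apply/eqP; ring.
have mus0 s : mus s != 0 by rewrite eq_complex /= (gt_eqF eps0).
have i0 : 'i%C != 0 :> C by rewrite eq_complex /= oner_eq0 andbF.
have -> : \sum_(s : 'I_N * 'I_q) ring_coef Psi m n N s.1 s.2 * cexpN_primitive (mus s) L
   = \sum_(s : 'I_N * 'I_q) ring_coef Psi m n N s.1 s.2 / mus s
     + - \sum_(s : 'I_N * 'I_q) ring_coef Psi m n N s.1 s.2 * cexpN (mus s) L / mus s.
  rewrite -sumrB; apply: eq_bigr => s _.
  by rewrite /cexpN_primitive (negbTE (mus0 s)); ring.
have main : \sum_(s : 'I_N * 'I_q) ring_coef Psi m n N s.1 s.2 / mus s =
    - 'i%C^-1 * a * (N%:R^-1 * \sum_(r < N) cis (- (angle R N r * n%:R))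
       / (w + w^-1 - (2 * cos (angle R N r))%:C%C)).
  rewrite sum_pairE /=.
  rewrite !mulr_sumr; apply: eq_bigr => r _.
  have -> : w + w^-1 - (2 * cos (angle R N r))%:C%C = \prod_l (z - (lam (momentum R p N r) l)%:C%C).
    by rewrite DE -wE /momentum mulrCA divff // mulr1.
  rewrite {1}(aE (momentum R p N r)).
  set P := \prod_l _; have P0 : P != 0 by apply/prodf_neq0 => l _.
  set S := (X in P * X).
  transitivity (N%:R^-1 * cis (- (angle R N r * n%:R)) * (- 'i%C^-1 * S)); last first.
    by field; rewrite ?P0 ?i0 ?pnatr_eq0 -?lt0n ?N0.
  rewrite /S !mulr_sumr; apply: eq_bigr => l _; rewrite musE /ring_coef /ring_weight.
  by rewrite invfM invrN !mulrA; congr (_ / _); ring.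
have main_ge : phi / (32 * width j) <=
    nc (\sum_(s : 'I_N * 'I_q) ring_coef Psi m n N s.1 s.2 / mus s).
  rewrite main !Normc.normcM ncN Normc.normcV.
  have -> : nc 'i%C = 1 by rewrite /= expr0n expr1n add0r sqrtr1.
  rewrite invr1 mul1r.
  have ga : phi / width j <= nc a by rewrite ler_pdivrMr // mulrC.
  have := @green_function_lower_bound R N n w; rewrite n0 nN => /(_ isT w0 w1).
  rewrite Normc.normcM => h.
  have {}h := h _ w4.
  have -> : phi / (32 * width j) = phi / width j * (1 / 32) by field; rewrite gt_eqF.
  apply: ler_pM => //; first by rewrite divr_ge0 ?sqr_ge0 // ltW.
  by apply: le_trans (h _); lra.
have err_le : nc (\sum_(s : 'I_N * 'I_q) ring_coef Psi m n N s.1 s.2 * cexpN (mus s) L / mus s)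
    <= expR (- T^-1 * L) * T.
  apply: le_trans (nc_sum _ _ _) _.
  have -> : expR (- T^-1 * L) * T =
      \sum_(s : 'I_N * 'I_q) nc (ring_coef Psi m n N s.1 s.2) * (expR (- T^-1 * L) * T).
    rewrite -mulr_suml sum_pairE /=.
    by rewrite (ring_coef_sum es) // mul1r.
  apply: ler_sum => s _; rewrite 2!Normc.normcM Normc.normcV nc_cexpN -mulrA.
  rewrite ler_wpM2l ?nc_ge0 // ler_wpM2l ?expR_ge0 // -[leRHS]invrK.
  rewrite lef_pV2 ?posrE // ?lt_neqAle ?nc_ge0 ?andbT 1?eq_sym ?nc_eq0 ?mus0 //.
  by apply: le_trans (Re_le_nc (mus s)); rewrite /= ger0_norm // ltW.
have := nc_geB (\sum_(s : 'I_N * 'I_q) ring_coef Psi m n N s.1 s.2 / mus s)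
  (- \sum_(s : 'I_N * 'I_q) ring_coef Psi m n N s.1 s.2 * cexpN (mus s) L / mus s).
rewrite ncN; lra.
Qed.

Hypothesis phi0 : 0 < phi.

Lemma site_integral_bound (F : R -> R) :
  measurable_fun (`[0%R, +oo[%classic : set (g_sigma_algebraType R.-ocitv.-measurable)) F ->
  (forall t : R, 0 <= t -> 0 <= F t <= 2 * expR (- (2 / T) * t)) ->
  (forall t : R, 0 <= t ->
     nc (amplitude V t (n%:Z * q%:Z + m) m) ^+ 2 * expR (- (2 / T) * t) <= F t) ->
  phi ^+ 2 / (2 ^+ 16 * pi * q%:R ^+ 2 * width j)
    <= \int[lebesgue_measure]_(t in `[0, +oo[) F t.
Proof.
move=> mF Fb ampF; have p0 := pi_gt0 R; have eps0 : 0 < T^-1 by rewrite invr_gt0.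
have q0 : 0 < q%:R :> R by rewrite ltr0n.
set d := width j / (4 * q%:R ^+ 2).
have d0 : 0 < d by rewrite divr_gt0 // mulr_gt0 ?exprn_gt0.
set gam := phi / (64 * width j).
have gam0 : 0 < gam by rewrite divr_gt0 // mulr_gt0.
pose K := Num.bound (T ^+ 2 * d / (gam * (2 * pi))).
have K0 : (0 < K.+1)%N by [].
set L := 2 * pi * K.+1%:R / d.
have L0 : 0 < L by rewrite divr_gt0 // !mulr_gt0.
have gp0 : 0 < gam * (2 * pi) by apply: mulr_gt0 => //; apply: mulr_gt0.
have L_large : expR (- T^-1 * L) * T <= gam.
  have : T ^+ 2 * d / (gam * (2 * pi)) < K.+1%:R.
    apply: lt_trans (archi_boundP _) _; last by rewrite ltr_nat.
    by apply: ltW; apply: divr_gt0 => //; apply: mulr_gt0 => //; apply: exprn_gt0.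
  rewrite ltr_pdivrMr // => h.
  have TL : T ^+ 2 <= gam * L.
    rewrite /L mulrA ler_pdivlMr //; apply: ltW; apply: lt_le_trans h _.
    by rewrite le_eqVlt; apply/orP; left; apply/eqP; ring.
  rewrite mulNr expRN mulrC ler_pdivrMr ?expR_gt0 //.
  apply: (@le_trans _ _ (gam * (T^-1 * L))).
    have -> : gam * (T^-1 * L) = (gam * L) / T by ring.
    by rewrite ler_pdivlMr // -expr2.
  rewrite ler_pM2l //; apply: le_trans (expR_ge1Dx _); lra.
set del := d * gam ^+ 2 / (8 * pi * L).
have del0 : 0 < del.
  apply: divr_gt0; first by apply: mulr_gt0 => //; apply: exprn_gt0.
  by apply: mulr_gt0 => //; apply: mulr_gt0.
have /choice[y yP] : forall r : 'I_K.+1, exists y : R, [/\ 0 < y < 1, 1 / 2 <= y ^+ n &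
    forall N L, (n < N)%N -> y ^+ (N - n) <= 1 / 4 -> 0 < L ->
    phi / (32 * width j) - expR (- T^-1 * L) * T <=
      nc (ring_transform N L (grid (lam mid_momentum j) d K.+1 r))].
  move=> r; apply: green_sample; apply/andP; split.
    by apply: mulr_ge0 => //; apply: divr_ge0 => //; exact: ltW.
  rewrite -/d mulrA ler_pdivrMr ?ltr0n // mulrC ler_pM2l // ler_nat.
  exact: ltnW.
near \oo => N.
have nN : (n < N)%N by near: N; exact: nbhs_infty_gt.
have N0 : (0 < N)%N by exact: leq_ltn_trans (leq0n n) nN.
have close : forall t, `|t| <= L -> nc (amplitude V t (n%:Z * q%:Z + m) m -
    ring_amplitude lam Psi m n N t) <= del.
  by near: N; exact: (ring_amplitude_cvg es Vq VM).
have y_small : forall r, y r ^+ (N - n) <= 1 / 4.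
  near: N; apply: filter_forall => r; have [/andP[y0 y1] _ _] := yP r.
  have : y r ^+ k @[k --> \oo] --> 0 by apply: cvg_expr; rewrite gtr0_norm.
  have q4 : (0 : R) < 1 / 4 by lra.
  move=> /cvgrPdist_le /(_ _ q4) [K1 _ hK1]; near=> N.
  have K1N : (K1 + n <= N)%N by near: N; exact: nbhs_infty_ge.
  have /hK1 : (K1 <= N - n)%N by rewrite leq_subRL ?(leq_trans (leq_addl K1 n)) // addnC.
  by rewrite /= sub0r normrN ger0_norm // exprn_ge0 // ltW.
have sample_ge (r : 'I_K.+1) : gam <= nc (ring_transform N L (grid (lam mid_momentum j) d K.+1 r)).
  have [_ _ h] := yP r; apply: le_trans (h _ _ nN (y_small r) L0).
  have -> : phi / (32 * width j) = 2 * gam by rewrite /gam; field; rewrite gt_eqF.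
  lra.
have [J [c' [mu' [pw prim]]]] := bessel_expsum (fun s : 'I_N * 'I_q => ring_coef Psi m n N s.1 s.2)
  (fun s => lam (momentum R p N s.1) s.2) T^-1 (lam mid_momentum j) K0 d0.
rewrite -/L in prim.
have := @expsum_le_integral R F 2 (2 / T) L (- (2 * del)) J c' mu' _ _ L0 mF Fb.
rewrite divr_gt0 // ler0n => /(_ isT isT) h.
apply: le_trans (h _); last first.
  move=> t /andP[t0 tL]; apply: le_trans (ampF _ t0).
  have {}close : nc (amplitude V t (n%:Z * q%:Z + m) m - ring_amplitude lam Psi m n N t) <= del.
    by apply: close; rewrite ger0_norm.
  have := ring_amplitude_le1 es m n t N0; set f := amplitude _ _ _ _; set g := ring_amplitude _ _ _ _ _ _ => g1.
  have gh : nc (\sum_(s : 'I_N * 'I_q) (ring_coef Psi m n N s.1 s.2 * cexpN (T^-1 +i* lam (momentum R p N s.1) s.2)%C t))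
      = nc g * expR (- T^-1 * t).
    have -> : \sum_(s : 'I_N * 'I_q) (ring_coef Psi m n N s.1 s.2 * cexpN (T^-1 +i* lam (momentum R p N s.1) s.2)%C t)
       = g * (expR (- T^-1 * t))%:C%C.
      rewrite /g /ring_amplitude mulr_suml.
      rewrite sum_pairE /=.
      apply: eq_bigr => r _; rewrite mulr_suml; apply: eq_bigr => s _.
      by rewrite /cexpN /= [t * _]mulrC; ring.
    by rewrite Normc.normcM nc_real ger0_norm ?expR_ge0.
  have /= := pw t; rewrite gh exprMn.
  have -> : expR (- T^-1 * t) ^+ 2 = expR (- (2 / T) * t).
    by rewrite -expRM_natl; congr expR; ring.
  set e := expR _; have e1 : 0 <= e <= 1.
    rewrite expR_ge0 expR_le1 mulNr oppr_le0 mulr_ge0 ?divr_ge0 // ltW //.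
  move=> pwt; rewrite lerBlDr; apply: le_trans pwt _; rewrite -lerBlDr.
  apply: damped_square_le => //; rewrite ?nc_ge0 ?(ltW del0) //.
  by have := nc_leD (g - f) f; rewrite subrK; move/le_trans; apply; rewrite lerD2r -ncN opprB.
rewrite prim.
have sum_ge : K.+1%:R * gam ^+ 2 <= \sum_(r < K.+1) nc (ring_transform N L (grid (lam mid_momentum j) d K.+1 r)) ^+ 2.
  rewrite -[K.+1 in leLHS]card_ord mulr_natl -sumr_const; apply: ler_sum => r _.
  by rewrite lerXn2r ?nnegrE ?nc_ge0 // ltW.
have alg (P K' D G : R) : 0 < P -> 0 < K' -> 0 < D ->
    (2 * P * K' / D)^-1 * (K' * G ^+ 2)
    - 2 * (D * G ^+ 2 / (8 * P * (2 * P * K' / D))) * (2 * P * K' / D) = D * G ^+ 2 / (4 * P).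
  by move=> P0 K'0 D0; field; rewrite !gt_eqF.
have alg2 (P Q W f : R) : 0 < P -> 0 < Q -> 0 < W ->
    W / (4 * Q ^+ 2) * (f / (64 * W)) ^+ 2 / (4 * P) = f ^+ 2 / (2 ^+ 16 * P * Q ^+ 2 * W).
  by move=> P0 Q0 W0; field; rewrite !gt_eqF.
rewrite -alg2 // -(alg _ K.+1%:R) ?ltr0n //.
rewrite -/L -/del mulNr lerD2r ler_pM2l ?invr_gt0 //.
Unshelve. all: by end_near. Qed.

End Sampling.

End SiteBound.

Section SpectralWeight.
Variables (R : realType) (p : nat).
Local Notation C := R[i].
Local Notation nc := (@Normc.normc R).
Local Notation q := p.+1.

Lemma site_eq_mod (i : 'I_q) (m : int) : (site i == m %[mod q%:Z])%Z = (i == cell_index p m).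
Proof.
rewrite -(eqz_modDr (p./2)%:Z) /site /= subrK modz_small ?ltz_nat ?ltn_ord //.
rewrite -(inj_eq val_inj) /= /cell_index inordK.
  by rewrite -eqz_nat gez0_abs ?modz_ge0.
by rewrite -ltz_nat gez0_abs ?modz_ge0 // ltz_pmod.
Qed.

Lemma spectral_weightE (v : 'cV[C]_q) :
  spectral_weight v = nc (v (cell_index p 0) 0) ^+ 2 + nc (v (cell_index p 1) 0) ^+ 2.
Proof.
have basisE m : abs2 (cinner v (basis_vec R q m)) = nc (v (cell_index p m) 0) ^+ 2.
  rewrite /abs2 /cinner (bigD1 (cell_index p m)) //= mxE site_eq_mod eqxx mulr1 big1 ?addr0.
    by rewrite nc_conj.
  by move=> i /negbTE im; rewrite mxE site_eq_mod im mulr0.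
by rewrite /spectral_weight !basisE.
Qed.

Lemma exists_heavy_state (lam : 'I_q -> R) (Psi : 'I_q -> 'cV[C]_q) (I : set R) (eta : R) :
  0 < eta -> (eta%:E < spectral_measure lam Psi I)%E ->
  exists2 j, I (lam j) & eta / q%:R < spectral_weight (Psi j).
Proof.
move=> eta0 etaI; apply: contrapT => /forall2NP none.
have q0 : (0 : R) < q%:R by rewrite ltr0n.
suff : (spectral_measure lam Psi I <= eta%:E)%E by rewrite leNgt etaI.
have -> : eta%:E = (\sum_(j < q) (eta / q%:R)%:E)%E.
  by rewrite sumEFin sumr_const card_ord -[_ *+ _]mulr_natr divfK // gt_eqF.
apply: lee_sum => j _; rewrite diracE -EFinM lee_fin.
have [|h] := none j.
  by move=> nI; rewrite memNset // mulr0 divr_ge0 // ltW.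
have : spectral_weight (Psi j) <= eta / q%:R by rewrite leNgt; apply/negP.
apply: le_trans; rewrite ler_piMr //; first by rewrite addr_ge0 ?sqr_ge0.
by case: (_ \in _).
Qed.

End SpectralWeight.

Lemma spectral_measure_le2 (R : realType) p (A : 'M[R[i]]_p.+1) lam Psi (I : set R) :
  eigensystem A lam Psi -> (spectral_measure lam Psi I <= 2%:E)%E.
Proof.
move=> es.
have -> : 2%:E = (\sum_(j < p.+1) (spectral_weight (Psi j))%:E)%E :> \bar R.
  rewrite sumEFin; under eq_bigr do rewrite spectral_weightE.
  by rewrite big_split /= !(eigensystem_weights es).
apply: lee_sum => j _; rewrite diracE -EFinM lee_fin ler_piMr ?addr_ge0 ?sqr_ge0 //.
by case: (_ \in _).
Qed.

Theorem lemma3 (R : realType) :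
  exists c c1 C : R, [/\ 0 < c, 0 < c1, 0 < C &
    forall (q : nat) (V : int -> R) (lam : R -> 'I_q -> R)
      (Psi : R -> 'I_q -> 'cV[R[i]]_q) (I : interval R) (eta : R),
      (1 <= q)%N ->
      periodic V q ->
      (forall k : R, eigensystem (floquet V q k) (lam k) (Psi k)) ->
      0 < eta ->
      (eta%:E < ereal_inf [set spectral_measure (lam k) (Psi k) [set` I]
                          | k in `[0%R, (pi / q%:R)%R]])%E ->
      exists j : 'I_q, band lam j `&` [set` I] !=set0 /\
        forall T : R,
          C / c1 * eta ^- 2 * q%:R ^+ 8 * band_width lam j ^- 2 + 1 < T ->
          forall n : int,
            C * eta^-1 * q%:R ^+ 4 * (band_width lam j)^-1 < n%:~R ->
            n%:~R < c1 * eta * q%:R ^- 4 * band_width lam j * T ->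
            c * eta ^+ 2 / (q%:R ^+ 6 * band_width lam j * T)
              < abel_prob V T (n * q%:Z)].
Proof.
exists (2 ^- 20), (64^-1), 1; split; rewrite ?invr_gt0 ?exprn_gt0 //.
case=> // p V lam Psi I eta _ Vq es eta0 inf_eta.
set q := p.+1; have q1 : 1 <= q%:R :> R by rewrite ler1n.
have q0 : 0 < q%:R :> R by lra.
have p0 := pi_gt0 R.
have [M M0 VM] := periodic_bounded (ltn0Sn p) Vq.
have kq : mid_momentum R p \in `[0, pi / q%:R].
  rewrite in_itv /= /mid_momentum divr_ge0 ?divr_ge0 ?(ltW p0) ?(ltW q0) //=.
  by rewrite ler_pM2r ?invr_gt0 //; lra.
have etaI : (eta%:E < spectral_measure (lam (mid_momentum R p)) (Psi (mid_momentum R p)) [set` I])%E.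
  by apply: lt_le_trans inf_eta _; apply: ereal_inf_lbound; exists (mid_momentum R p).
have eta2 : eta <= 2.
  by rewrite -lee_fin; apply: le_trans (ltW etaI) _; exact: (spectral_measure_le2 _ (es _)).
have [j jI wj] := exists_heavy_state eta0 etaI.
exists j; split.
  by exists (lam (mid_momentum R p) j); split=> //; exists (mid_momentum R p).
move=> T T_large n n_large n_small.
set w := band_width lam j in T_large n_large n_small *.
have w_ge0 : 0 <= w by exact: normr_ge0.
have T0 : 0 < T.
  have e2 : 0 <= eta ^- 2 by rewrite invr_ge0 sqr_ge0.
  have w2 : 0 <= w ^- 2 by rewrite invr_ge0 sqr_ge0.
  have q8 : 0 <= q%:R ^+ 8 :> R by exact: exprn_ge0.
  have c0 : 0 <= 1 / 64^-1 :> R by lra.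
  apply: le_lt_trans T_large; apply: addr_ge0 => //.
  by apply: mulr_ge0 => //; apply: mulr_ge0 => //; apply: mulr_ge0.
have n0 : 0 < n.
  rewrite -(ltr0z R); apply: le_lt_trans n_large.
  have e1 : 0 <= eta^-1 by rewrite invr_ge0 ltW.
  have w1 : 0 <= w^-1 by rewrite invr_ge0.
  have q4 : 0 <= q%:R ^+ 4 :> R by exact: exprn_ge0.
  by apply: mulr_ge0 => //; apply: mulr_ge0 => //; rewrite mul1r.
have w0 : 0 < w.
  rewrite lt_neqAle w_ge0 andbT; apply/eqP => w0.
  by move: n_small; rewrite -w0 mulr0 mul0r ltNge ler0z ltW.
case: n n0 n_large n_small => // n n0 n_large n_small.
have {}n0 : (0 < n)%N by [].
have slow : 512 * q%:R ^+ 3 * n%:R ^+ 2 <= w ^+ 2 * T ^+ 2.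
  have h : 32 * q%:R ^+ 4 * n%:R <= w * T.
    have : n%:R * q%:R ^+ 4 <= 64^-1 * eta * w * T.
      rewrite -ler_pdivlMr ?exprn_gt0 //; apply: le_trans (ltW n_small) _.
      by rewrite le_eqVlt; apply/orP; left; apply/eqP; ring.
    have : eta * (w * T) <= 2 * (w * T) by rewrite ler_pM2r // mulr_gt0.
    lra.
  have q3 : q%:R ^+ 3 <= (q%:R ^+ 4) ^+ 2 :> R.
    by rewrite -exprM; apply: ler_weXn2l.
  have : (32 * q%:R ^+ 4 * n%:R) ^+ 2 <= (w * T) ^+ 2.
    by rewrite lerXn2r ?nnegrE ?mulr_ge0 ?exprn_ge0 // ltW.
  rewrite [in leRHS]exprMn => h'; apply: le_trans h'.
  have -> : (32 * q%:R ^+ 4 * n%:R) ^+ 2 = 1024 * (q%:R ^+ 4) ^+ 2 * n%:R ^+ 2 :> R by ring.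
  have q30 : 0 <= q%:R ^+ 3 :> R by exact: exprn_ge0.
  by rewrite ler_wpM2r ?sqr_ge0 //; lra.
have [m m01 wm] : exists2 m : int, m = 0 \/ m = 1 &
    eta / (2 * q%:R) < Normc.normc (Psi (mid_momentum R p) j (cell_index p m) 0) ^+ 2.
  move: wj; rewrite spectral_weightE.
  have -> : eta / q%:R = 2 * (eta / (2 * q%:R)) by field; rewrite gt_eqF.
  move=> h; have [h0|h0] := ltP (eta / (2 * q%:R))
    (Normc.normc (Psi (mid_momentum R p) j (cell_index p 0) 0) ^+ 2).
    by exists 0 => //; left.
  by exists 1; [right|lra].
set phi := Normc.normc _ ^+ 2 in wm.
have e0 : 0 < eta / (2 * q%:R) by rewrite divr_gt0 // mulr_gt0.
have phi0 : 0 < phi by exact: lt_trans wm.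
set F := fun t => (abs2 (amplitude V t (n%:Z * q%:Z) 0) + abs2 (amplitude V t (n%:Z * q%:Z + 1) 1))
  * expR (- (2 * t / T)).
have expE (t : R) : expR (- (2 / T) * t) = expR (- (2 * t / T)) by congr expR; ring.
have amp_le m' t : abs2 (amplitude V t (n%:Z * q%:Z + m') m') <= 1.
  by rewrite /abs2 expr_le1 ?nc_ge0 //; exact: (amplitude_le1 es Vq VM).
have abs2_ge0 z : 0 <= abs2 z :> R by exact: sqr_ge0.
have amp0 t : abs2 (amplitude V t (n%:Z * q%:Z) 0) = abs2 (amplitude V t (n%:Z * q%:Z + 0) 0).
  by rewrite addr0.
have bound : phi ^+ 2 / (2 ^+ 16 * pi * q%:R ^+ 2 * w) <= \int[lebesgue_measure]_(t in `[0, +oo[) F t.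
  apply: (site_integral_bound es Vq VM (m := m) (n := n) (T := T)) => //.
  - apply: measurable_funM.
      apply: measurable_funD; last exact: (measurable_abs2_amplitude es Vq VM).
      by have := measurable_abs2_amplitude es Vq VM 0 n; rewrite addr0.
    apply: measurable_funTS; apply: continuous_measurable_fun.
    rewrite (_ : (fun t => _) = expR \o *%R (- (2 / T))); last by apply/funext => t /=; rewrite expE.
    by move=> t; apply: continuous_comp; [exact: mulrl_continuous|exact: continuous_expR].
  - move=> t t0; rewrite expE mulr_ge0 ?addr_ge0 ?expR_ge0 //= ler_wpM2r ?expR_ge0 //.
    by rewrite amp0; have := amp_le 0 t; have := amp_le 1 t; lra.
  - move=> t t0; rewrite expE ler_wpM2r ?expR_ge0 // amp0 -/(abs2 _).
    by case: m01 => ->; rewrite ?lerDl ?lerDr.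
rewrite /abel_prob -/F.
have pi8 : pi < 8 :> R by have := pihalf_lt2 R; lra.
have main : 2 / T * (phi ^+ 2 / (2 ^+ 16 * pi * q%:R ^+ 2 * w)) <= 2 / T * \int[lebesgue_measure]_(t in `[0, +oo[) F t.
  by rewrite ler_pM2l // divr_gt0.
apply: lt_le_trans main.
have phi2 : (eta / (2 * q%:R)) ^+ 2 < phi ^+ 2 by rewrite ltrXn2r // ?nnegrE ltW.
have den0 : 0 < 2 ^+ 16 * pi * q%:R ^+ 2 * w.
  by do 2!apply: mulr_gt0 => //; [apply: mulr_gt0|apply: exprn_gt0] => //; apply: exprn_gt0.
apply: (@lt_trans _ _ (2 / T * ((eta / (2 * q%:R)) ^+ 2 / (2 ^+ 16 * pi * q%:R ^+ 2 * w)))); last first.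
  by rewrite ltr_pM2l ?divr_gt0 // ltr_pM2r // invr_gt0.
have alg (P Q W E S : R) : 0 < P -> 0 < Q -> 0 < W -> 0 < S ->
    2 / S * ((E / (2 * Q)) ^+ 2 / (2 ^+ 16 * P * Q ^+ 2 * W)) =
    (2 ^+ 3 * Q ^+ 2 / P) * (2 ^- 20 * E ^+ 2 / (Q ^+ 6 * W * S)).
  by move=> P0 Q0 W0 S0; field; rewrite !gt_eqF.
rewrite alg // ltr_pMl; last first.
  apply: divr_gt0; last by do 2!apply: mulr_gt0 => //; apply: exprn_gt0.
  by apply: mulr_gt0; rewrite ?invr_gt0 exprn_gt0.
rewrite ltr_pdivlMr // mul1r; have : 1 <= q%:R ^+ 2 :> R by rewrite expr_ge1.
lra.
Qed.
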